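(* Let $E$ be an arbitrary Banach lattice and let $F$ be a Banach lattice which is either an AM-space or has order continuous norm. Then $K^r_{AM-un}(E,F)$ is a Banach lattice under the norm $\|\cdot\|_{AM-un}$.
   Context: For $x\in E_+$, $[-x,x]=\{y\in E:-x\le y\le x\}$. A net $(y_\alpha)$ in $F$ is un-convergent to $y\in F$ if $\||y_\alpha-y|\wedge u\|\to 0$ for every $u\in F_+$. A continuous linear operator $T:E\to F$ is AM-un-compact if for every $x\in E_+$ the bounded set $T[-x,x]$ is un-compact, meaning that every net in $T[-x,x]$ has a subnet that is un-convergent in $F$. $K_{AM-un}(E,F)$ is the set of AM-un-compact operators $E\to F$; operators are ordered by $S\le T$ iff $Sx\le Tx$ for all $x\in E_+$, and $K^+_{AM-un}(E,F)$ is the set of positive elements of $K_{AM-un}(E,F)$. Let $$K^r_{AM-un}(E,F)=\{T\in K_{AM-un}(E,F): \pm T\le S \text{ for some } S\in K^+_{AM-un}(E,F)\}$$ with the induced order. For $T\in K^r_{AM-un}(E,F)$ the AM-un-norm is $$\|T\|_{AM-un}=\inf\{\|S\|: S\in K^+_{AM-un}(E,F),\ S\ge \pm T\},$$ where $\|S\|$ is the operator norm. A Banach lattice $X$ is an AM-space if $\|x\vee y\|=\max\{\|x\|,\|y\|\}$ for all $x,y\in X_+$. A Banach lattice has order continuous norm if $x_\alpha\downarrow 0$ implies $\|x_\alpha\|\to 0$. *)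

(* Defs.v *)
From HB Require Import structures.
From mathcomp Require Import all_boot all_order all_algebra.
From mathcomp Require Import all_classical all_reals all_analysis.

Set Implicit Arguments.
Unset Strict Implicit.
Unset Printing Implicit Defensive.

Import Order.TTheory GRing.Theory Num.Theory.
Import numFieldNormedType.Exports.

Local Open Scope classical_set_scope.
Local Open Scope ring_scope.

(* Real Banach lattices, with `|x| : R the norm of x.  The lattice operations
   are fields here, and the Order.Lattice instance is derived from them
   afterwards, because the hierarchy has no join of Order.Lattice with normed
   modules that Hierarchy Builder could extend. *)
HB.mixin Record isBanachLattice (R : realType) V of CompleteNormedModule R V := {
  bl_le : rel V ;
  bl_meet : V -> V -> V ;
  bl_join : V -> V -> V ;
  bl_le_refl : reflexive bl_le ;
  bl_le_anti : antisymmetric bl_le ;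
  bl_le_trans : transitive bl_le ;
  bl_meetP : forall x y z, bl_le x (bl_meet y z) = bl_le x y && bl_le x z ;
  bl_joinP : forall x y z, bl_le (bl_join x y) z = bl_le x z && bl_le y z ;
  bl_leD2r : forall x y z : V, bl_le x y -> bl_le (x + z) (y + z) ;
  bl_scaler_ge0 : forall (a : R) (x : V),
    0 <= a -> bl_le 0 x -> bl_le 0 (a *: x) ;
  bl_norm_mono : forall x y : V,
    bl_le (bl_join x (- x)) (bl_join y (- y)) -> `|x| <= `|y|
}.

#[short(type="banachLatticeType")]
HB.structure Definition BanachLattice (R : realType) :=
  { V of CompleteNormedModule R V & isBanachLattice R V }.

Section order.
Context (R : realType) (V : banachLatticeType R).

HB.instance Definition _ := Order.Le_isPOrder.Build ring_display V
  (@bl_le_refl R V) (@bl_le_anti R V) (@bl_le_trans R V).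

HB.instance Definition _ :=
  Order.POrder_MeetJoin_isLattice.Build ring_display V
    (@bl_meetP R V) (@bl_joinP R V).

End order.

(* The lattice-theoretic absolute value, `|_| being the norm. *)
Definition modulus (R : realType) (E : banachLatticeType R) (x : E) : E :=
  Order.join x (- x).

(* The set [-x, x]. *)
Definition sym_itv (R : realType) (E : banachLatticeType R) (x : E) : set E :=
  [set y | - x <= y /\ y <= x].

Record directedSet := DirectedSet {
  dcarrier :> Type ;
  dle : dcarrier -> dcarrier -> Prop ;
  dinhabited : inhabited dcarrier ;
  dle_refl : forall i, dle i i ;
  dle_trans : forall i j k, dle i j -> dle j k -> dle i k ;
  dle_directed : forall i j, exists k, dle i k /\ dle j k
}.

(* A net in T is a function from a directed set to T; it converges along the
   filter generated by the tails of its index set. *)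
Definition tails (I : directedSet) : set_system I :=
  filter_from setT (fun i => [set j | dle i j]).
Arguments tails I : clear implicits.

Global Instance tails_proper_filter (I : directedSet) : ProperFilter (tails I).
Proof.
apply: filter_from_proper; last by move=> i _; exists i; exact: dle_refl.
apply: filter_from_filter; first by have [i] := dinhabited I; exists i.
move=> i j _ _; have [k [ik jk]] := dle_directed i j; exists k => // l kl.
by split; apply: dle_trans kl.
Qed.

(* y \o h is a subnet of the net y : I -> T. *)
Definition is_subnet_map (I J : directedSet) (h : J -> I) : Prop :=
  forall i, exists j0, forall j, dle j0 j -> dle i (h j).

Definition un_cvg (R : realType) (F : banachLatticeType R)
    (I : directedSet) (y : I -> F) (l : F) : Prop :=
  forall u : F, 0 <= u ->
    `|Order.meet (modulus (y i - l)) u| @[i --> tails I] --> (0 : R).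

Definition un_compact (R : realType) (F : banachLatticeType R) (A : set F) :
    Prop :=
  forall (I : directedSet) (y : I -> F), (forall i, A (y i)) ->
    exists (J : directedSet) (h : J -> I) (l : F),
      is_subnet_map h /\ un_cvg (y \o h) l.

Definition AM_space (R : realType) (F : banachLatticeType R) : Prop :=
  forall x y : F, 0 <= x -> 0 <= y -> `|Order.join x y| = Num.max `|x| `|y|.

(* x decreases to 0. *)
Definition net_decr0 (R : realType) (F : banachLatticeType R)
    (I : directedSet) (x : I -> F) : Prop :=
  [/\ forall i j, dle i j -> x j <= x i,
      forall i, 0 <= x i &
      forall z, (forall i, z <= x i) -> z <= 0].

Definition order_continuous_norm (R : realType) (F : banachLatticeType R) :
    Prop :=
  forall (I : directedSet) (x : I -> F), net_decr0 x ->
    `|x i| @[i --> tails I] --> (0 : R).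

(* Operators are elements of the function space E -> F, whose vector space
   structure is the pointwise one. *)
Section operators.
Context (R : realType) (E F : banachLatticeType R).
Implicit Types S T : E -> F.

Definition op_le S T : Prop := forall x : E, 0 <= x -> S x <= T x.

Definition opnorm T : R := sup [set `|T x| | x in [set x : E | `|x| <= 1]].

Definition K_AMun : set (E -> F) :=
  [set T | [/\ linear T, continuous T &
    forall x : E, 0 <= x -> un_compact (T @` sym_itv x)]].

Definition K_AMun_pos : set (E -> F) := [set T | K_AMun T /\ op_le 0 T].

Definition K_AMun_dominating T : set (E -> F) :=
  [set S | [/\ K_AMun_pos S, op_le T S & op_le (- T) S]].

Definition K_AMun_reg : set (E -> F) :=
  [set T | K_AMun T /\ K_AMun_dominating T !=set0].

Definition AMun_norm T : R := inf [set opnorm S | S in K_AMun_dominating T].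

End operators.
Arguments K_AMun_reg {R} E F.

(* The subset A of V, with the vector operations of V, the order le and the
   norm nrm, is a Banach lattice: A is the image of a Banach lattice under a
   linear bijection that identifies the orders and the norms.  In particular A
   is a linear subspace of V. *)
Definition is_banach_lattice (R : realType) (V : lmodType R) (A : set V)
    (le : V -> V -> Prop) (nrm : V -> R) : Prop :=
  exists (X : banachLatticeType R) (phi : X -> V),
    [/\ linear phi, set_bij setT A phi,
        forall x y, x <= y <-> le (phi x) (phi y) &
        forall x, nrm (phi x) = `|x|].

(* Main.v *)
Require Import Defs.
From HB Require Import structures.
From mathcomp Require Import all_boot all_order all_algebra.
From mathcomp Require Import all_classical all_reals all_analysis.
Set Implicit Arguments.
Unset Strict Implicit.
Unset Printing Implicit Defensive.
Import Order.TTheory GRing.Theory Num.Theory.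
Import numFieldNormedType.Exports.
Local Open Scope classical_set_scope.
Local Open Scope ring_scope.

(** An order-bounded set is un-compact exactly when it is totally bounded:
    truncating differences at a large order bound does not change them, so on it
    un-convergence is norm convergence.  An operator dominated by a positive one
    maps order intervals to order-bounded sets.  The regular AM-un-compact
    operators are therefore the AM-compact operators dominated by a positive
    AM-compact operator ([K_AMun_regP]), and the un-topology can be forgotten.

    The main point is that such an operator [T] has an AM-compact modulus, namely
    [|T| x = sup T[-x, x]] for [x >= 0].  If [F] is an AM-space or has order
    continuous norm, this supremum exists and is the norm limit of finite joins
    of points of [T[-x, x]] ([totally_bounded_lub]): in an AM-space because
    [T[-x, x]] is totally bounded, and under order continuity because an upward
    directed order-bounded set is Cauchy.  The Riesz decomposition makes [|T|]
    additive ([op_modulus_cone]) and also compact: a finite join [v] of values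
    [T y] with [y] in [[-x, x]] that is close to [|T| x] gives, after splitting
    each [y] along [x = z + (x - z)], finite joins of points of [T[-x, x]] that
    are equally close to [|T| z], uniformly in [z] in [[0, x]]
    ([op_modulus_totally_bounded]).

    The operators dominating [T] are those above [|T|], so the AM-un-norm of [T]
    is the operator norm of [|T|].  It is a lattice norm, it bounds the operator
    norm of [T], and [T |-> |T|] is a contraction for it.  A Cauchy filter of
    regular operators thus has an operator-norm limit [L], which is AM-compact;
    for a fixed regular [T] the moduli [|S - T|] converge as well, to an
    AM-compact operator dominating [L - T], so the convergence to [L] holds in
    the AM-un-norm ([limit_sub_reg]). *)

(** * Order and norm in a Banach lattice *)

Lemma subr_subACA (U : zmodType) (a b c d : U) :
  a - b - (c - d) = (a - c) - (b - d).
Proof. by rewrite !opprB ![_ + (d - _)]addrACA [- b - c]addrC. Qed.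

(** A factor [e / (c + 1)] turns an operator estimate, proportional to the
    norm [c] of the argument, into an absolute one; the [+ 1] covers [c = 0]. *)
Lemma ltr_div_succ_mul (R : realFieldType) (e c : R) :
  0 < e -> 0 <= c -> e / (c + 1) * c < e.
Proof.
move=> e0 c0; rewrite mulrAC -mulrA gtr_pMr// ltr_pdivrMr ?mul1r ?ltrDl//.
by rewrite ltr_wpDl.
Qed.

(** Zero is written [(0 : V)] so that it is the zero of the additive group [V],
    on which the ring identities rewrite, and not that of an ordered group
    structure which is only convertible to it. *)
Section banach_lattice_theory.
Context (R : realType) (V : banachLatticeType R).
Implicit Types (x y z u v w : V) (a : R).

Lemma bl_leD2rE x y z : (x + z <= y + z) = (x <= y).
Proof.
by apply/idP/idP => [/(@bl_leD2r R V _ _ (- z))|/bl_leD2r]; rewrite ?addrK //; exact.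
Qed.

Lemma bl_leD2lE x y z : (z + x <= z + y) = (x <= y).
Proof. by rewrite ![z + _]addrC bl_leD2rE. Qed.

Lemma bl_leD x y u v : x <= y -> u <= v -> x + u <= y + v.
Proof.
by move=> xy uv; apply: (@le_trans _ _ (y + u)); rewrite ?bl_leD2rE ?bl_leD2lE.
Qed.

Lemma bl_subr_ge0 x y : ((0 : V) <= y - x) = (x <= y).
Proof. by rewrite -[LHS](bl_leD2rE _ _ x) add0r subrK. Qed.

Lemma bl_leBrDr x y z : (x <= y - z) = (x + z <= y).
Proof. by rewrite -[LHS](bl_leD2rE _ _ z) subrK. Qed.

Lemma bl_leBlDr x y z : (x - z <= y) = (x <= y + z).
Proof. by rewrite -[LHS](bl_leD2rE _ _ z) subrK. Qed.

Lemma bl_leN2 x y : (- x <= - y) = (y <= x).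
Proof. by rewrite -[LHS]bl_subr_ge0 opprK addrC bl_subr_ge0. Qed.

Lemma bl_addr_ge0 x y : (0 : V) <= x -> (0 : V) <= y -> (0 : V) <= x + y.
Proof. by move=> x0 y0; rewrite -[0 : V]addr0 bl_leD. Qed.

Lemma bl_leZ a x y : 0 <= a -> x <= y -> a *: x <= a *: y.
Proof.
move=> a0 xy; rewrite -bl_subr_ge0 -scalerBr; apply: bl_scaler_ge0 => //.
by rewrite -[bl_le _ _]/(_ <= _) bl_subr_ge0.
Qed.

Lemma bl_scale_ge0 a x : 0 <= a -> (0 : V) <= x -> (0 : V) <= a *: x.
Proof. exact: bl_scaler_ge0. Qed.

Lemma bl_half_double x : 2^-1 *: (x + x) = x.
Proof. by rewrite scalerDr -scalerDl -[2^-1]div1r -splitr scale1r. Qed.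

Lemma bl_double_le x y : x + x <= y + y -> x <= y.
Proof.
move=> xy; rewrite -(bl_half_double x) -(bl_half_double y).
by apply: bl_leZ; rewrite // invr_ge0.
Qed.

Lemma bl_double_ge0 x : (0 : V) <= x + x -> (0 : V) <= x.
Proof. by move=> x0; apply: bl_double_le; rewrite addr0. Qed.

Lemma le_modulus x : x <= modulus x.
Proof. exact: leUl. Qed.

Lemma leN_modulus x : - x <= modulus x.
Proof. exact: leUr. Qed.

Lemma modulus_le x y : (modulus x <= y) = (x <= y) && (- x <= y).
Proof. exact: leUx. Qed.

Lemma modulus_ge0 x : 0 <= modulus x.
Proof.
by apply: bl_double_ge0; rewrite -(subrr x) bl_leD ?le_modulus ?leN_modulus.
Qed.

Lemma modulusN x : modulus (- x) = modulus x.
Proof. by rewrite /modulus opprK joinC. Qed.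

Lemma modulusD x y : modulus (x + y) <= modulus x + modulus y.
Proof.
by rewrite modulus_le opprD !bl_leD ?le_modulus ?leN_modulus.
Qed.

Lemma bl_norm_le x y : - y <= x -> x <= y -> `|x| <= `|y|.
Proof.
move=> yx xy; apply: bl_norm_mono; apply: (@le_trans _ V y); last exact: leUl.
by rewrite -[_ <= _]/(modulus x <= y) modulus_le xy -bl_leN2 opprK.
Qed.

Lemma bl_norm_le_ge0 x y : (0 : V) <= x -> x <= y -> `|x| <= `|y|.
Proof.
move=> x0 xy; apply: bl_norm_le => //; apply: le_trans (x0).
by rewrite -oppr0 bl_leN2 (le_trans x0).
Qed.

Lemma norm_le_modulus x y : modulus x <= y -> `|x| <= `|y|.
Proof.
by rewrite modulus_le => /andP[xy Nxy]; apply: bl_norm_le; rewrite // -bl_leN2 opprK.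
Qed.

Lemma norm_modulus x : `|modulus x| = `|x|.
Proof.
apply/le_anti/andP; split; last exact: norm_le_modulus.
apply: bl_norm_mono; rewrite -[bl_le _ _]/(_ <= _).
by rewrite leUx lexx andTb (le_trans _ (modulus_ge0 x))// -oppr0 bl_leN2 modulus_ge0.
Qed.

(** The positive cone is norm-closed: if [0 <= y] then the negative part of [x]
    is at most the modulus of [x - y], hence as small in norm as [x - y]. *)
Lemma bl_ge0_closed x :
  (forall e, 0 < e -> exists2 y, (0 : V) <= y & `|x - y| <= e) -> (0 : V) <= x.
Proof.
move=> xcl; pose z := Order.join (- x) 0.
have z0 : (0 : V) <= z by exact: leUr.
suff zE : z = 0 by rewrite -bl_leN2 oppr0 -zE leUl.
apply/normr0_eq0/eqP; rewrite eq_le normr_ge0 andbT; apply/ler_addgt0Pl => e e0.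
rewrite addr0; have [y y0 xy] := xcl e e0; apply: le_trans xy.
rewrite -norm_modulus; apply: bl_norm_le_ge0 => //.
rewrite leUx modulus_ge0 andbT -modulusN opprB (le_trans _ (le_modulus _))//.
by rewrite -{1}[- x]add0r bl_leD2rE.
Qed.

Lemma bl_le_closed x y :
  (forall e, 0 < e -> exists2 z, (0 : V) <= z & `|(y - x) - z| <= e) -> x <= y.
Proof. by move=> xcl; rewrite -bl_subr_ge0; exact: bl_ge0_closed. Qed.

(** The summand in [sym_itv x] is [z] moved into that interval as little as
    possible: raised to [z - y] or [- x], then cut off at [x]. *)
Lemma Riesz_decomposition x y z : (0 : V) <= x -> (0 : V) <= y -> sym_itv (x + y) z ->
  exists u, sym_itv x u /\ sym_itv y (z - u).
Proof.
move=> x0 y0 [/= z1 z2].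
have Nx : - x <= x by rewrite (le_trans _ x0)// -oppr0 bl_leN2.
have Ny : z - y <= z + y by rewrite bl_leD2lE (le_trans _ y0)// -oppr0 bl_leN2.
have h1 : - x <= z + y by rewrite -bl_leBlDr -opprD.
have h2 : z - y <= x by rewrite bl_leBlDr.
exists (Order.meet (Order.join (z - y) (- x)) x); split; split.
- by rewrite lexI leUr.
- exact: leIr.
- rewrite bl_leBrDr addrC bl_leBlDr (le_trans (leIl _ _))//.
  by rewrite leUx Ny h1.
- by rewrite bl_leBlDr addrC -bl_leBlDr lexI h2 leUl.
Qed.

Lemma join_addr x y z : Order.join x y + z = Order.join (x + z) (y + z).
Proof.
apply/le_anti/andP; split; last by rewrite leUx !bl_leD2rE leUl leUr.
by rewrite -bl_leBrDr leUx !bl_leBrDr leUl leUr.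
Qed.

(** Lipschitz continuity of the join: it makes the finite joins of points of
    totally bounded sets totally bounded. *)
Lemma norm_join_sub x y u v :
  `|Order.join x y - Order.join u v| <= `|x - u| + `|y - v|.
Proof.
rewrite -(norm_modulus (x - u)) -(norm_modulus (y - v)).
apply: le_trans (ler_normD _ _); apply: norm_le_modulus.
have key (x' y' u' v' : V) : Order.join x' y' - Order.join u' v' <=
    modulus (x' - u') + modulus (y' - v').
  rewrite bl_leBlDr leUx; apply/andP; split.
    rewrite -{1}(subrK u' x') bl_leD ?leUl// (le_trans (le_modulus _))//.
    by rewrite -{1}[modulus _]addr0 bl_leD2lE modulus_ge0.
  rewrite -{1}(subrK v' y') bl_leD ?leUr// (le_trans (le_modulus _))//.
  by rewrite -{1}[modulus _]add0r bl_leD2rE modulus_ge0.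
by rewrite modulus_le key opprB -(modulusN (x - u)) -(modulusN (y - v)) !opprB key.
Qed.

Lemma meet_addl_le x y u : (0 : V) <= x -> (0 : V) <= y -> (0 : V) <= u ->
  Order.meet (x + y) u <= Order.meet x u + Order.meet y u.
Proof.
move=> x0 y0 u0; have le_addr v w : (0 : V) <= w -> v <= v + w.
  by rewrite -[X in X <= _ + _]addr0 bl_leD2lE.
rewrite [_ + Order.meet y u]addrC -bl_leBlDr lexI; apply/andP; split.
  rewrite bl_leBlDr [y + _]addrC -bl_leBlDr lexI !bl_leBlDr leIl.
  by rewrite (le_trans (leIr _ _))// le_addr.
by rewrite bl_leBlDr (le_trans (leIr _ _))// le_addr// lexI x0 u0.
Qed.

End banach_lattice_theory.

(** * Total boundedness and un-compactness *)

Section totally_bounded.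
Context (R : realType).
Implicit Types (V W : normedModType R).

Definition totally_bounded V (A : set V) :=
  forall e : R, 0 < e -> exists l : seq V,
    (forall b, b \in l -> A b) /\
    forall a, A a -> exists2 b, b \in l & `|a - b| <= e.

(** The balls covering [C] are centred in [C] but a covering of [A] must be
    centred in [A]; so every center having a point of [A] within [e / 2] is
    replaced by such a point, which costs a second [e / 2]. *)
Lemma totally_bounded_approx V (A : set V) :
  (forall e : R, 0 < e -> exists2 C : set V, totally_bounded C &
     forall a, A a -> exists2 c, C c & `|a - c| <= e) ->
  totally_bounded A.
Proof.
move=> Acl e e0; have e4 : 0 < e / 2 / 2 by rewrite !divr_gt0.
have [C tbC AC] := Acl _ e4; have [l [_ lC]] := tbC _ e4.
pose near_b b := [set a | A a /\ `|a - b| <= e / 2].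
(* 0 is a dummy default: the centers with no point of A nearby are dropped. *)
pose l' := [seq xget 0 (near_b b) | b <- l & `[< near_b b !=set0 >]].
exists l'; split=> [a /mapP[b]|a Aa].
  by rewrite mem_filter => /andP[/asboolP ne _] ->; have [] := xgetPex 0 ne.
have [c Cc ac] := AC a Aa; have [b bl cb] := lC c Cc.
have ab : `|a - b| <= e / 2.
  by rewrite -(subrKA c) [e / 2]splitr (le_trans (ler_normD _ _))// lerD.
have ne : near_b b !=set0 by exists a.
have [_ gb] := xgetPex 0 ne; exists (xget 0 (near_b b)).
  by apply/mapP; exists b => //; rewrite mem_filter bl andbT; exact/asboolP.
rewrite -(subrKA b) [e]splitr (le_trans (ler_normD _ _))// lerD//.
by rewrite distrC.
Qed.

Lemma totally_bounded_subset V (A B : set V) :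
  A `<=` B -> totally_bounded B -> totally_bounded A.
Proof.
move=> AB tbB; apply: totally_bounded_approx => e e0; exists B => // a Aa.
by exists a; [exact: AB|rewrite subrr normr0 ltW].
Qed.

Lemma totally_bounded_image V W (f : V -> W) (K : R) (A : set V) :
  0 < K -> (forall a c, `|f a - f c| <= K * `|a - c|) ->
  totally_bounded A -> totally_bounded (f @` A).
Proof.
move=> K0 fK tbA e e0; have [l [lA Al]] := tbA (e / K) (divr_gt0 e0 K0).
exists [seq f b | b <- l]; split=> [_ /mapP[b bl ->]|_ [a Aa <-]].
  by exists b => //; exact: lA.
have [b bl ab] := Al a Aa; exists (f b); first exact: map_f.
by rewrite (le_trans (fK _ _))// mulrC -ler_pdivlMr.
Qed.

Lemma totally_bounded_image2 V W (f : V -> V -> W) (A B : set V) :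
  (forall a b c d, `|f a b - f c d| <= `|a - c| + `|b - d|) ->
  totally_bounded A -> totally_bounded B ->
  totally_bounded [set f a b | a in A & b in B].
Proof.
move=> f1 tbA tbB e e0; have e2 : 0 < e / 2 by rewrite divr_gt0.
have [l [lA Al]] := tbA _ e2; have [m [mB Bm]] := tbB _ e2.
exists [seq f a b | a <- l, b <- m]; split=> [_ /allpairsP[[a b] [/= al bm ->]]|].
  by exists a; [exact: lA|exists b => //; exact: mB].
move=> _ [a Aa [b Bb <-]].
have [c cl ac] := Al a Aa; have [d dm bd] := Bm b Bb.
exists (f c d); first by apply/allpairsP; exists (c, d).
by rewrite (le_trans (f1 _ _ _ _))// [e]splitr lerD.
Qed.

End totally_bounded.

Section un_compactness.
Context (R : realType) (F : banachLatticeType R).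
Implicit Types (A : set F) (u w : F).

Lemma un_cvg_tail (I : directedSet) (y : I -> F) l u :
  un_cvg y l -> (0 : F) <= u -> forall e : R, 0 < e ->
  exists i, forall j, dle i j -> `|Order.meet (modulus (y j - l)) u| <= e.
Proof.
move=> yl u0 e e0; have := yl u u0.
move=> /cvgrPdist_le/(_ e e0)[i _ iP]; exists i => j /iP.
by rewrite /= sub0r normrN normr_id.
Qed.

Definition list_directedSet (T : choiceType) : directedSet.
Proof.
refine (@DirectedSet (seq T) (fun s t => {subset s <= t})
  (inhabits [::]) _ _ _).
- by move=> s x.
- by move=> s t r st tr x /st/tr.
- move=> s t; exists (s ++ t).
  by split=> x xs; rewrite mem_cat xs ?orbT.
Defined.

(** Inside [sym_itv w] differences are dominated by [w + w], so truncating them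
    at [w + w] changes nothing and un-convergence is norm convergence.  If [A]
    is not totally bounded, every finite list [s] of points misses some
    [y s] of [A] by [e]; the net [y], indexed by lists under inclusion, has no
    norm-Cauchy subnet. *)
Lemma un_compact_totally_bounded A w :
  A `<=` sym_itv w -> un_compact A -> totally_bounded A.
Proof.
move=> Aw cptA; apply: contrapT => /existsNP[e /not_implyP[e0 ne]].
have bad (l : seq F) : exists a, A a /\
    forall b, b \in l -> A b -> e < `|a - b|.
  apply: contrapT => /forallNP la; apply: ne; exists [seq b <- l | `[< A b >]].
  split=> [b|a Aa]; first by rewrite mem_filter => /andP[/asboolP].
  apply: contrapT => nb; apply: (la a); split=> // b bl Ab.
  rewrite ltNge; apply/negP => ab; apply: nb; exists b => //.
  by rewrite mem_filter bl andbT; exact/asboolP.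
have /choice[y yP] := bad.
have [J [h [l [hsub hl]]]] := cptA (list_directedSet F) y (fun s => (yP s).1).
have w2 a b : A a -> A b -> modulus (a - b) <= w + w.
  move=> /Aw[wa aw] /Aw[wb bw]; rewrite modulus_le opprB !bl_leD// -bl_leN2 opprK //.
have [j0] := dinhabited J.
have w20 : (0 : F) <= w + w.
  exact: le_trans (modulus_ge0 _) (w2 _ _ (yP (h j0)).1 (yP (h j0)).1).
have [j1 j1P] := un_cvg_tail hl w20 (divr_gt0 e0 (ltr0n R 2)).
have [j2 j2P] := hsub [:: y (h j1)].
have [k [j1k j2k]] := dle_directed j1 j2.
have := (yP (h k)).2 (y (h j1)) (j2P k j2k _ (mem_head _ _)) (yP _).1.
apply/negP; rewrite -leNgt [e]splitr.
apply: le_trans (lerD (j1P k j1k) (j1P j1 (dle_refl _))).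
set a := y (h k); set b := y (h j1).
rewrite -norm_modulus; apply: le_trans (ler_normD _ _).
apply: bl_norm_le_ge0; first exact: modulus_ge0.
apply: (@le_trans _ F (Order.meet (modulus (a - l) + modulus (b - l)) (w + w))).
  rewrite lexI w2 ?andbT; [|exact: (yP _).1..].
  rewrite -(modulusN (b - l)) opprB; apply: le_trans (modulusD _ _).
  by rewrite subrKA.
by apply: meet_addl_le => //; exact: modulus_ge0.
Qed.

(** An ultrafilter contains one of the finitely many sets of a cover. *)
Lemma ultra_has (T : Type) (X : eqType) (U : set_system T) (P : X -> set T)
    (l : seq X) :
  UltraFilter U -> (forall t, exists2 b, b \in l & P b t) ->
  exists b, U (P b).
Proof.
move=> UU lP; apply: contrapT => /forallNP nU.
have : U (fun t => forall b, b \in l -> ~ P b t).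
  elim: l {lP} => [|b l IH]; first by apply: filterS filterT.
  have [/nU//|Ub] := in_ultra_setVsetC (P b) UU.
  apply: filterS2 Ub IH => t /= nb nl c; rewrite inE => /orP[/eqP -> //|]; exact: nl.
move=> /filter_ex[t nt]; have [b bl bt] := lP t; exact: nt bt.
Qed.

(** Along an ultrafilter finer than the tails, a net in a totally bounded set
    is Cauchy, so it converges to some [l].  The pairs of an index [j] and a
    radius [r] with [`|l - y j| <= r] then index a subnet converging to [l]. *)
Lemma totally_bounded_un_compact A : totally_bounded A -> un_compact A.
Proof.
move=> tbA I y Ay.
have [U [UU tU]] := ultraFilterLemma (tails_proper_filter I).
have /cvg_ex[/= l yl] : cvg (y @ U).
  apply: cauchy_cvg; apply: cauchy_exP => e e0.
  have [s [_ sA]] := tbA (e / 2) (divr_gt0 e0 (ltr0n R 2)).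
  have [|b Ub] := @ultra_has _ _ U (fun b i => `|y i - b| <= e / 2) s UU.
    by move=> i; exact: sA.
  exists b; rewrite -ball_normE; apply: (@filterS _ U _ _ _ _ Ub) => i /= yb.
  by rewrite distrC (le_lt_trans yb)// gtr_pMr// invf_lt1// ltr1n.
have clus i (e : R) : 0 < e -> exists2 j, dle i j & `|l - y j| <= e.
  move=> e0; have Ui : U [set j | dle i j] by apply: tU; exists i.
  have /cvgrPdist_le/(_ e e0) Ue := yl.
  by have [j [ij lj]] := filter_ex (filterI Ui Ue); exists j.
pose J := {p : I * R | 0 < p.2 /\ `|l - y p.1| <= p.2}.
pose leJ (p q : J) := dle (sval p).1 (sval q).1 /\ (sval q).2 <= (sval p).2.
have inhJ : inhabited J.
  have [i0] := dinhabited I; have [i _ il] := clus i0 1 ltr01.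
  by constructor; exists (i, 1).
have reflJ p : leJ p p by split => //; exact: dle_refl.
have transJ p q r : leJ p q -> leJ q r -> leJ p r.
  by move=> [pq1 pq2] [qr1 qr2]; split; [exact: dle_trans qr1|exact: le_trans pq2].
have dirJ p q : exists r, leJ p r /\ leJ q r.
  have [k [pk qk]] := dle_directed (sval p).1 (sval q).1.
  have m0 : 0 < Num.min (sval p).2 (sval q).2.
    by rewrite lt_min; case: (svalP p) => -> _; case: (svalP q) => -> _.
  have [j kj lj] := clus k _ m0.
  exists (exist _ (j, Num.min (sval p).2 (sval q).2) (conj m0 lj)).
  by split; split; rewrite /= ?ge_min ?lexx ?orbT//; apply: dle_trans kj.
exists (DirectedSet inhJ reflJ transJ dirJ), (fun p => (sval p).1), l; split.
  move=> i; have [j ij jl] := clus i 1 ltr01.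
  exists (exist _ (j, 1) (conj ltr01 jl)) => p [jp _]; exact: dle_trans jp.
move=> u u0; apply/cvgrPdist_le => e e0.
have [i0] := dinhabited I; have [i _ il] := clus i0 e e0.
exists (exist _ (i, e) (conj e0 il)) => // p [/= _ pe].
rewrite sub0r normrN normr_id; apply: le_trans pe.
have [_ /= pl] := svalP p; apply: le_trans pl.
rewrite distrC -[leRHS]norm_modulus; apply: bl_norm_le_ge0; last exact: leIl.
by rewrite lexI modulus_ge0.
Qed.

End un_compactness.

(** * Suprema as norm limits of finite joins *)

Section suprema.
Context (R : realType) (F : banachLatticeType R).
Implicit Types (A D : set F) (s u v w z : F).

Definition is_lub A s := forall z, s <= z <-> forall a, A a -> a <= z.

(** The joins of nonempty finite families of points of [A], generated
    inductively: every use of them is an induction on the family. *)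
Inductive fin_join A : set F :=
| fin_join1 a : A a -> fin_join A a
| fin_joinU u v : fin_join A u -> fin_join A v -> fin_join A (Order.join u v).

Definition directed_up D := forall u v, D u -> D v ->
  exists2 w, D w & u <= w /\ v <= w.

(** For an upward directed [D], the Cauchy condition on [D] viewed as an
    increasing net. *)
Definition cauchy_up D := forall e : R, 0 < e ->
  exists2 v, D v & forall u, D u -> v <= u -> `|u - v| <= e.

Lemma fin_join_directed A : directed_up (fin_join A).
Proof.
by move=> u v Au Av; exists (Order.join u v); [exact: fin_joinU|rewrite leUl leUr].
Qed.

Lemma fin_join_le A z u : (forall a, A a -> a <= z) -> fin_join A u -> u <= z.
Proof. by move=> Az; elim=> [a /Az//|v w _ vz _ wz]; rewrite leUx vz wz. Qed.

Lemma cauchy_up_lub D : D !=set0 -> directed_up D -> cauchy_up D ->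
  exists2 s, is_lub D s & forall e : R, 0 < e -> exists2 v, D v & `|s - v| <= e.
Proof.
move=> [d0 Dd0] dirD cD.
pose G := filter_from D (fun v => [set u | D u /\ v <= u]).
have PG : ProperFilter G.
  apply: filter_from_proper; last by move=> v Dv; exists v.
  apply: filter_from_filter; first by exists d0.
  move=> u v Du Dv; have [w Dw [uw vw]] := dirD u v Du Dv; exists w => // x [Dx wx].
  by split; split=> //; [exact: le_trans wx|exact: le_trans wx].
have /cvg_ex[/= s Gs] : cvg G.
  apply: cauchy_cvg; apply: cauchy_exP => e e0.
  have [v Dv vP] := cD (e / 2) (divr_gt0 e0 (ltr0n R 2)).
  exists v; exists v => // u [Du vu]; rewrite -ball_normE /= distrC.
  by rewrite (le_lt_trans (vP _ Du vu))// gtr_pMr// invf_lt1// ltr1n.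
have near_s (e : R) v : 0 < e -> D v ->
    exists u, [/\ D u, v <= u & `|s - u| <= e].
  move=> e0 Dv; have Gv : G [set u | D u /\ v <= u] by exists v.
  have /cvgrPdist_le/(_ e e0) Ge : (id @ G) --> s by [].
  by have [u [[Du vu] su]] := filter_ex (filterI Gv Ge); exists u.
exists s => [z|e e0]; last by have [u [Du _ su]] := near_s e d0 e0 Dd0; exists u.
split=> [sz a Da|Dz].
  apply: le_trans sz; apply: bl_le_closed => e e0.
  have [u [Du au su]] := near_s e a e0 Da; exists (u - a).
    by rewrite bl_subr_ge0.
  by rewrite opprB addrA subrK.
apply: bl_le_closed => e e0; have [u [Du _ su]] := near_s e d0 e0 Dd0.
exists (z - u); first by rewrite bl_subr_ge0 Dz.
by rewrite opprB addrC addrA subrK distrC.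
Qed.

(** Let [v] be the join of a finite [e]-net of [A].  Each point of [A], and hence,
    by the AM identity [`|d1 \/ d2| = max `|d1| `|d2|], each finite join of such
    points, lies below [v + d] for some [d >= 0] of norm at most [e]. *)
Lemma AM_fin_join_cauchy A : AM_space F -> A !=set0 -> totally_bounded A ->
  cauchy_up (fin_join A).
Proof.
move=> AM [a0 Aa0] tbA e e0; have [l [lA Al]] := tbA e e0.
have [v Av lv] : exists2 v, fin_join A v & forall b, b \in l -> b <= v.
  elim: l lA {Al} => [|b l IH] lA; first by exists a0 => //; exact: fin_join1.
  have [|v Av lv] := IH; first by move=> c cl; apply: lA; rewrite inE cl orbT.
  exists (Order.join b v) => [|c].
    by apply: fin_joinU => //; apply/fin_join1/lA/mem_head.
  by rewrite inE => /orP[/eqP ->|/lv cv]; rewrite ?leUl// (le_trans cv)// leUr.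
have close u : fin_join A u ->
    exists d : F, [/\ (0 : F) <= d, `|d| <= e & u <= v + d].
  elim=> [a Aa|u1 u2 _ [d1 [d10 d1e ud1]] _ [d2 [d20 d2e ud2]]].
    have [b bl ab] := Al a Aa; exists (modulus (a - b)).
    split; [exact: modulus_ge0|by rewrite norm_modulus|].
    by rewrite -[X in X <= _](subrK b a) [_ + b]addrC bl_leD ?lv// le_modulus.
  exists (Order.join d1 d2); split.
  - by rewrite (le_trans d10)// leUl.
  - by rewrite AM// ge_max d1e d2e.
  - rewrite leUx (le_trans ud1) ?(le_trans ud2)// bl_leD2lE ?leUl ?leUr//.
exists v => // u /close[d [d0 de uvd]] vu; apply: le_trans de.
by apply: bl_norm_le_ge0; rewrite ?bl_subr_ge0// bl_leBlDr addrC.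
Qed.

(** The norm makes the order Archimedean: [n * `|z| <= `|w|] for all [n]. *)
Lemma bl_archimedean z w : (0 : F) <= z -> (forall n, z *+ n <= w) -> z = 0.
Proof.
move=> z0 zw; apply/eqP; rewrite -normr_le0 leNgt; apply/negP => nz.
have zn0 n : (0 : F) <= z *+ n.
  by elim: n => [|n IH]; rewrite ?mulr0n// mulrS bl_addr_ge0.
have := bl_norm_le_ge0 (zn0 _) (zw (Num.bound (`|w| / `|z|))).
rewrite normrMn -mulr_natl -ler_pdivlMr// leNgt => /negP; apply.
by apply: archi_boundP; rewrite divr_ge0.
Qed.

(** The differences [w' - v] of upper bounds [w'] of [D] and points [v] of [D]
    decrease to 0: if [z' >= 0] is below all of them, subtracting [z'] from an
    upper bound gives an upper bound, so [z' *+ n <= w - v] for all [n].  Order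
    continuity then yields such a difference of norm at most [e], and it
    dominates [u - v] for every [u] of [D] above [v]. *)
Lemma order_continuous_cauchy D w : order_continuous_norm F ->
  D !=set0 -> directed_up D -> (forall v, D v -> v <= w) -> cauchy_up D.
Proof.
move=> oc [d0 Dd0] dirD Dw e e0.
pose J := {p : F * F | (forall v, D v -> v <= p.1) /\ D p.2}.
pose leJ (p q : J) := (sval q).1 <= (sval p).1 /\ (sval p).2 <= (sval q).2.
have inhJ : inhabited J by constructor; exists (w, d0).
have reflJ p : leJ p p by split.
have transJ p q r : leJ p q -> leJ q r -> leJ p r.
  by move=> [pq1 pq2] [qr1 qr2]; split; [exact: le_trans pq1|exact: le_trans qr2].
have dirJ p q : exists r, leJ p r /\ leJ q r.
  case: p q => [[p1 p2] /= [Dp1 Dp2]] [[q1 q2] /= [Dq1 Dq2]].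
  have [r2 Dr2 [pr qr]] := dirD _ _ Dp2 Dq2.
  have Dr1 v : D v -> v <= Order.meet p1 q1.
    by move=> Dv; rewrite lexI Dp1 ?Dq1.
  exists (exist _ (Order.meet p1 q1, r2) (conj Dr1 Dr2)).
  by split; split; rewrite //= ?leIl ?leIr.
pose x (p : DirectedSet inhJ reflJ transJ dirJ) : F := (sval p).1 - (sval p).2.
have decx : net_decr0 x.
  split=> [p q [pq1 pq2]|[[p1 p2] /= [Dp1 Dp2]]|z zx].
  - by rewrite bl_leD// bl_leN2.
  - by rewrite bl_subr_ge0 Dp1.
  suff z0 : Order.join z 0 = 0 by rewrite -z0 leUl.
  set z' := Order.join z 0; have z'0 : (0 : F) <= z' by exact: leUr.
  have z'x p : z' <= x p.
    by rewrite leUx zx bl_subr_ge0; case: p => [[p1 p2] /= [Dp1 Dp2]]; exact: Dp1.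
  (* Iterated: w - z' *+ n is still an upper bound of D. *)
  have ub n v : D v -> v <= w - z' *+ n.
    elim: n v => [|n IH] v Dv; first by rewrite mulr0n subr0 Dw.
    have z'v : z' + v <= w - z' *+ n.
      by rewrite -bl_leBrDr; exact: z'x (exist _ (w - z' *+ n, v) (conj IH Dv)).
    by rewrite mulrSr opprD addrA bl_leBrDr [v + _]addrC.
  apply: (@bl_archimedean _ (w - d0)) => // n.
  by rewrite bl_leBrDr [_ + d0]addrC -bl_leBrDr ub.
have /cvgrPdist_le/(_ e e0)[p _ /(_ p (reflJ p))] := oc _ x decx.
case: p => [[p1 p2] /= [Dp1 Dp2]]; rewrite sub0r normrN normr_id => xe.
exists p2 => // u Du p2u; apply: le_trans xe.
by apply: bl_norm_le_ge0; rewrite ?bl_subr_ge0// bl_leD2rE Dp1.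
Qed.

(** The only place where the alternative on [F] is used. *)
Lemma totally_bounded_lub A w : AM_space F \/ order_continuous_norm F ->
  A !=set0 -> totally_bounded A -> (forall a, A a -> a <= w) ->
  exists2 s, is_lub A s &
    forall e : R, 0 < e -> exists2 v, fin_join A v & `|s - v| <= e.
Proof.
move=> hF [a0 Aa0] tbA Aw.
have D0 : fin_join A !=set0 by exists a0; exact: fin_join1.
have [|s sD sapp] := @cauchy_up_lub (fin_join A) D0 (@fin_join_directed A).
  case: hF => [AM|oc]; first by apply: AM_fin_join_cauchy => //; exists a0.
  apply: (order_continuous_cauchy oc D0 (@fin_join_directed A)) => v Dv.
  exact: fin_join_le Aw Dv.
exists s => // z; split=> [/sD sz a Aa|Az]; first exact/sz/fin_join1.
by apply/sD => v Dv; exact: fin_join_le Az Dv.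
Qed.

End suprema.

(** * AM-compact operators *)

Section linear_operators.
Context (R : realType) (E F : banachLatticeType R).
Implicit Types (S T : E -> F) (x y : E).

Lemma linear_bundle T : linear T -> exists L : {linear E -> F}, T = L.
Proof.
move=> lT; pose L : {linear E -> F} := HB.pack T (GRing.isLinear.Build R E F _ T lT).
by exists L.
Qed.

Lemma linear_continuous_bound T : linear T -> continuous T ->
  exists2 C : R, 0 <= C & forall x, `|T x| <= C * `|x|.
Proof.
move=> /linear_bundle[L ->] cL.
have [c [_ cP]] := (linear_boundedP _).1 ((linear_bounded_continuous _).2 cL).
exists (Num.max c 0 + 1); first by rewrite addr_ge0// le_max lexx orbT.
by apply: cP; rewrite ltr_pwDr// le_max lexx.
Qed.

Lemma bound_linear_continuous T (C : R) : linear T ->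
  (forall x, `|T x| <= C * `|x|) -> continuous T.
Proof.
move=> /linear_bundle[L ->] LC; apply/linear_bounded_continuous/linear_boundedP.
exists C; split; first exact: num_real.
by move=> M CM x; rewrite (le_trans (LC x))// ler_wpM2r// ltW.
Qed.

Lemma opnorm_has_sup T : linear T -> continuous T ->
  has_sup [set `|T x| | x in [set x : E | `|x| <= 1]].
Proof.
move=> lT cT; split; first by exists `|T 0|, 0 => //=; rewrite normr0.
have [C C0 TC] := linear_continuous_bound lT cT.
by exists C => _ [x /= x1 <-]; rewrite (le_trans (TC x))// ler_piMr.
Qed.

Lemma opnorm_bound T x : linear T -> continuous T -> `|T x| <= opnorm T * `|x|.
Proof.
move=> lT cT; have supT := opnorm_has_sup lT cT.
have [->|x0] := eqVneq x 0.
  have [L TL] := linear_bundle lT.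
  by rewrite TL linear0 !normr0 mulr0.
have nx0 : 0 < `|x| by rewrite normr_gt0.
rewrite -ler_pdivrMr//; apply: (ub_le_sup supT.2).
exists (`|x|^-1 *: x) => /=; first by rewrite normfZV.
have [L TL] := linear_bundle lT.
by rewrite TL linearZ /= normrZ ger0_norm ?invr_ge0// mulrC.
Qed.

Lemma opnorm_le T (C : R) : 0 <= C -> (forall x, `|T x| <= C * `|x|) ->
  opnorm T <= C.
Proof.
move=> C0 TC; apply: ge_sup; first by exists `|T 0|, 0 => //=; rewrite normr0.
by move=> _ [x /= x1 <-]; rewrite (le_trans (TC x))// ler_piMr.
Qed.

Lemma opnorm_ge0 T : linear T -> continuous T -> 0 <= opnorm T.
Proof.
move=> lT cT; rewrite (le_trans (normr_ge0 (T 0)))//.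
apply: (ub_le_sup (opnorm_has_sup lT cT).2).
by exists 0 => //=; rewrite normr0.
Qed.

(** AM-compactness, that is relative norm compactness of the images of order
    intervals, expressed by total boundedness since [F] is complete. *)
Definition AM_compact T := [/\ linear T, continuous T &
  forall x, (0 : E) <= x -> totally_bounded (T @` sym_itv x)].

Definition dominates S T := forall x, (0 : E) <= x -> T x <= S x /\ - T x <= S x.

Lemma dominates_ge0 S T x : dominates S T -> (0 : E) <= x -> (0 : F) <= S x.
Proof.
move=> dST /dST[Tx NTx]; apply: bl_double_ge0.
by rewrite -(subrr (T x)) bl_leD.
Qed.

(** Both [x + y] and [x - y] are positive, [S x + S x] is the sum of their
    images under [S] and [T y + T y] the difference of their images under [T]. *)
Lemma dominates_sym_itv S T x y : linear S -> linear T -> dominates S T ->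
  sym_itv x y -> sym_itv (S x) (T y).
Proof.
move=> /linear_bundle[s ->] /linear_bundle[t ->] dst [xy yx].
have xy0 : (0 : E) <= x + y by rewrite -(opprK y) bl_subr_ge0 -bl_leN2 opprK.
have yx0 : (0 : E) <= x - y by rewrite bl_subr_ge0.
have [p1 p2] := dst _ xy0; have [q1 q2] := dst _ yx0.
have sE : s x + s x = s (x + y) + s (x - y).
  by rewrite linearB linearD addrACA subrr addr0.
have tE : t y + t y = t (x + y) - t (x - y).
  by rewrite linearB linearD opprB [t x + _]addrC addrACA subrr addr0.
split; apply: bl_double_le; last by rewrite sE tE bl_leD.
by rewrite -opprD sE tE -bl_leN2 opprK opprB [s _ + _]addrC bl_leD.
Qed.

Lemma dominates_norm S T x : linear S -> linear T -> dominates S T ->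
  `|T x| <= `|S (modulus x)|.
Proof.
move=> lS lT dST; have [] : sym_itv (S (modulus x)) (T x).
  apply: dominates_sym_itv => //; split; last exact: le_modulus.
  by rewrite -bl_leN2 opprK leN_modulus.
exact: bl_norm_le.
Qed.

Lemma dominates_opnorm S T x : linear S -> continuous S -> linear T ->
  dominates S T -> `|T x| <= opnorm S * `|x|.
Proof.
move=> lS cS lT dST; rewrite (le_trans (dominates_norm x lS lT dST))//.
by rewrite -(norm_modulus x) opnorm_bound.
Qed.

(** A dominated operator maps order intervals to order-bounded sets, where
    un-compactness is total boundedness. *)
Lemma K_AMun_AM_compact S T : linear S -> dominates S T -> K_AMun T ->
  AM_compact T.
Proof.
move=> lS dST [lT cT uT]; split=> // x x0.
apply: (@un_compact_totally_bounded _ _ _ (S x)); last exact: uT.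
by move=> _ [y xy <-]; exact: dominates_sym_itv xy.
Qed.

Lemma AM_compact_K_AMun T : AM_compact T -> K_AMun T.
Proof.
by move=> [lT cT tT]; split=> // x x0; apply/totally_bounded_un_compact/tT.
Qed.

(** A positive operator dominates itself, so here and in the next lemma
    AM-un-compact operators can be exchanged for AM-compact ones. *)
Lemma K_AMun_dominatingP S T :
  K_AMun_dominating T S <-> AM_compact S /\ dominates S T.
Proof.
split=> [[[KS S0] TS NTS]|[cS dST]].
  split; last by move=> x x0; split; [exact: TS|exact: NTS].
  have [lS _ _] := KS; apply: (@K_AMun_AM_compact S) => //.
  move=> x x0; have Sx := S0 x x0; split => //.
  by apply: le_trans (Sx); rewrite -oppr0 bl_leN2; exact: Sx.
split; last 2 first.
- by move=> x /dST[].
- by move=> x /dST[].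
split; first exact: AM_compact_K_AMun.
by move=> x x0; exact: (dominates_ge0 dST).
Qed.

Lemma K_AMun_regP T :
  K_AMun_reg E F T <-> AM_compact T /\ exists2 S, AM_compact S & dominates S T.
Proof.
split=> [[KT [S /K_AMun_dominatingP[cS dST]]]|[cT [S cS dST]]].
  split; last by exists S.
  by apply: K_AMun_AM_compact KT => //; [|exact: dST]; case: cS.
split; first exact: AM_compact_K_AMun.
by exists S; apply/K_AMun_dominatingP.
Qed.

Lemma AM_compact_closed T :
  (forall e : R, 0 < e -> exists2 S, AM_compact S &
     forall x, `|T x - S x| <= e * `|x|) -> AM_compact T.
Proof.
move=> Tcl.
have lT : linear T.
  move=> a x y; apply/eqP; rewrite -subr_eq0 -normr_le0; apply/ler_addgt0Pl => e e0.
  rewrite addr0.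
  pose K := `|a *: x + y| + (`|a| * `|x| + `|y|).
  have K0 : 0 <= K by rewrite !addr_ge0// mulr_ge0.
  have eK0 : 0 < e / (K + 1) by rewrite divr_gt0// ltr_wpDl.
  have [_ [/linear_bundle[L ->] _ _] TL] := Tcl _ eK0.
  have -> : T (a *: x + y) - (a *: T x + T y) = (T (a *: x + y) - L (a *: x + y))
      - (a *: (T x - L x) + (T y - L y)).
    by rewrite linearP scalerBr addrACA -opprD opprB addrA subrK.
  rewrite (le_trans (ler_normB _ _))//.
  rewrite (le_trans _ (ltW (ltr_div_succ_mul e0 K0)))// [leRHS]mulrDr.
  rewrite lerD ?TL// (le_trans (ler_normD _ _))// mulrDr lerD ?TL// normrZ mulrCA.
  by rewrite ler_wpM2l.
split=> //.
  have [S [lS cS _] TS] := Tcl 1 ltr01.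
  have [C C0 SC] := linear_continuous_bound lS cS.
  apply: (@bound_linear_continuous _ (1 + C)) => // x.
  rewrite -(subrK (S x) (T x)) (le_trans (ler_normD _ _))// mulrDl.
  by rewrite lerD ?TS ?SC.
move=> x x0; apply: totally_bounded_approx => e e0.
have nx : 0 < `|x| + 1 by rewrite ltr_wpDl.
have [S [lS cS tS] TS] := Tcl (e / (`|x| + 1)) (divr_gt0 e0 nx).
exists (S @` sym_itv x); first exact: tS.
move=> _ [y xy <-]; exists (S y); first by exists y.
rewrite (le_trans (TS y))// (le_trans _ (ltW (ltr_div_succ_mul e0 (normr_ge0 x))))//.
by rewrite ler_wpM2l ?(ltW (divr_gt0 e0 nx))//; case: xy; exact: bl_norm_le.
Qed.

Lemma AM_compact0 : AM_compact 0.
Proof.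
have l0 : linear (0 : E -> F) by move=> a x y; rewrite /= scaler0 addr0.
split=> //; first by apply: (@bound_linear_continuous _ 0) => // x; rewrite normr0 mul0r.
move=> x x0 e e0; exists [:: 0]; split.
  move=> b; rewrite inE => /eqP ->; exists 0 => //.
  by split; rewrite // -oppr0 bl_leN2.
by move=> _ [y _ <-]; exists 0; rewrite ?mem_head// subrr normr0 ltW.
Qed.

Lemma AM_compact_linear a S T : AM_compact S -> AM_compact T ->
  AM_compact (a *: S + T).
Proof.
move=> [/linear_bundle[s ->] cs ts] [/linear_bundle[t ->] ct tt].
split.
- move=> b x y; rewrite -[LHS]/(a *: s (b *: x + y) + t (b *: x + y)).
  rewrite -[RHS]/(b *: (a *: s x + t x) + (a *: s y + t y)).
  rewrite (linearP s) (linearP t) /= !scalerDr.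
  by rewrite !scalerA [a * b]mulrC addrACA.
- move=> x; apply: cvgD; last exact: ct.
  by apply: cvgZr; exact: cs.
move=> x x0; have K0 : 0 < `|a| + 1 by rewrite ltr_wpDl.
apply: (@totally_bounded_subset _ _ _
  [set u + v | u in ( *:%R a) @` (s @` sym_itv x) & v in t @` sym_itv x]).
  move=> _ [y xy <-]; exists (a *: s y); first by exists (s y) => //; exists y.
  by exists (t y) => //; exists y.
apply: totally_bounded_image2; last exact: tt.
  by move=> u v u' v'; rewrite opprD addrACA ler_normD.
apply: (totally_bounded_image K0); last exact: ts.
by move=> u v; rewrite -scalerBr normrZ ler_wpM2r// lerDl.
Qed.

(** Completeness of the AM-compact operators under the operator norm, stated
    with the pointwise estimates that characterize this norm. *)
Lemma AM_compact_limit (H : set_system (E -> F)) : ProperFilter H ->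
  H AM_compact ->
  (forall e : R, 0 < e -> exists T,
     H [set S | forall x, `|S x - T x| <= e * `|x|]) ->
  exists2 M, AM_compact M & forall e : R, 0 < e ->
     H [set S | forall x, `|M x - S x| <= e * `|x|].
Proof.
move=> PH HA Hc.
have cvgH x : cvg (S x @[S --> H]).
  apply: cauchy_cvg; apply: cauchy_exP => e e0.
  have nx : 0 < `|x| + 1 by rewrite ltr_wpDl.
  have [T HT] := Hc (e / (`|x| + 1)) (divr_gt0 e0 nx).
  exists (T x); rewrite -ball_normE; apply: (@filterS _ H _ _ _ _ HT) => S /= ST.
  by rewrite distrC (le_lt_trans (ST x))// ltr_div_succ_mul.
pose M x := lim (S x @[S --> H]).
have HM (e : R) : 0 < e -> H [set S | forall x, `|M x - S x| <= e * `|x|].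
  move=> e0; have [T HT] := Hc (e / 2) (divr_gt0 e0 (ltr0n R 2)).
  apply: (@filterS _ H _ _ _ _ HT) => S /= ST x.
  apply/ler_addgt0Pl => d d0.
  have /cvgrPdist_le/(_ d d0) Hd := cvgH x.
  have [S' [/= MS' S'T]] := filter_ex (filterI Hd HT).
  rewrite -(subrKA (S' x)) (le_trans (ler_normD _ _))// lerD//.
  rewrite -(subrKA (T x)) (le_trans (ler_normD _ _))//.
  by rewrite [e]splitr mulrDl lerD// distrC.
exists M => //; apply: AM_compact_closed => e e0.
by have [S [cS MS]] := filter_ex (filterI HA (HM e e0)); exists S.
Qed.

End linear_operators.

(** * The AM-un-norm *)

Section AMun_norm.
Context (R : realType) (E F : banachLatticeType R).
Implicit Types (S T : E -> F) (x y : E).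

Lemma AMun_norm_ge0 T : 0 <= AMun_norm T.
Proof.
rewrite /AMun_norm; have [->|ne] := eqVneq (K_AMun_dominating T) set0.
  by rewrite image_set0 inf0.
apply: lb_le_inf; first by move/set0P: ne => [S dS]; exists (opnorm S), S.
by move=> _ [S /K_AMun_dominatingP[[lS cS _] _] <-]; exact: opnorm_ge0.
Qed.

Lemma AMun_norm_le S T : AM_compact S -> dominates S T -> AMun_norm T <= opnorm S.
Proof.
move=> cS dST; apply: ge_inf; last by exists S => //; apply/K_AMun_dominatingP.
by exists 0 => _ [s /K_AMun_dominatingP[[lS cS' _] _] <-]; exact: opnorm_ge0.
Qed.

Lemma AMun_norm_approx T (e : R) : K_AMun_reg E F T -> 0 < e ->
  exists S, [/\ AM_compact S, dominates S T & opnorm S < AMun_norm T + e].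
Proof.
move=> [_ [S0 dS0]] e0.
have [|_ [S /K_AMun_dominatingP[cS dST] <-] Se] :=
    @inf_adherent R [set opnorm S | S in K_AMun_dominating T] e e0.
  split; first by exists (opnorm S0), S0.
  by exists 0 => _ [s /K_AMun_dominatingP[[lS cS' _] _] <-]; exact: opnorm_ge0.
by exists S.
Qed.

(** Transfers to the infimum an estimate valid for every dominating operator. *)
Lemma AMun_norm_bound T (C : R) x : K_AMun_reg E F T ->
  (forall S, AM_compact S -> dominates S T -> C <= opnorm S * `|x|) ->
  C <= AMun_norm T * `|x|.
Proof.
move=> KT CS; apply/ler_addgt0Pl => e e0.
have nx : 0 < `|x| + 1 by rewrite ltr_wpDl.
have [S [cS dST Se]] := AMun_norm_approx KT (divr_gt0 e0 nx).
rewrite (le_trans (CS S cS dST))// (le_trans (ler_wpM2r _ (ltW Se)))//.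
by rewrite mulrDl addrC lerD2r ltW// ltr_div_succ_mul.
Qed.

Lemma norm_le_AMun_norm T x : K_AMun_reg E F T -> `|T x| <= AMun_norm T * `|x|.
Proof.
move=> KT; apply: AMun_norm_bound => // S [lS cS _] dST.
by apply: dominates_opnorm => //; have [[]] := KT.
Qed.

Lemma dominates_linear a S1 S2 T1 T2 : dominates S1 T1 -> dominates S2 T2 ->
  dominates (`|a| *: S1 + S2) (a *: T1 + T2).
Proof.
move=> d1 d2 x x0; rewrite -[(_ + S2) x]/(`|a| *: S1 x + S2 x).
rewrite -[(_ + T2) x]/(a *: T1 x + T2 x) opprD.
have [p1 p2] := d1 x x0; have [q1 q2] := d2 x x0.
suff [] : a *: T1 x <= `|a| *: S1 x /\ - (a *: T1 x) <= `|a| *: S1 x.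
  by move=> r1 r2; split; exact: bl_leD.
have [a0|a0] := leP 0 a; first by rewrite ger0_norm// -scalerN !bl_leZ.
have -> : a *: T1 x = (- a) *: - T1 x by rewrite scalerN scaleNr opprK.
have Na0 : 0 <= - a by rewrite oppr_ge0 ltW.
by rewrite ltr0_norm// -scalerN opprK !bl_leZ.
Qed.

Lemma opnorm_linear a S T : AM_compact S -> AM_compact T ->
  opnorm (a *: S + T) <= `|a| * opnorm S + opnorm T.
Proof.
move=> [lS cS _] [lT cT _]; have S0 := opnorm_ge0 lS cS.
have T0 := opnorm_ge0 lT cT.
apply: opnorm_le => [|x]; first by rewrite addr_ge0// mulr_ge0.
rewrite mulrDl (le_trans (ler_normD _ _))// lerD ?opnorm_bound//.
by rewrite normrZ -mulrA ler_wpM2l// opnorm_bound.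
Qed.

Lemma K_AMun_reg_linear a S T : K_AMun_reg E F S -> K_AMun_reg E F T ->
  K_AMun_reg E F (a *: S + T).
Proof.
move=> /K_AMun_regP[cS [S' cS' dS]] /K_AMun_regP[cT [T' cT' dT]].
apply/K_AMun_regP; split; first exact: AM_compact_linear.
by exists (`|a| *: S' + T'); [exact: AM_compact_linear|exact: dominates_linear].
Qed.

Lemma AMun_norm_linear a S T : K_AMun_reg E F S -> K_AMun_reg E F T ->
  AMun_norm (a *: S + T) <= `|a| * AMun_norm S + AMun_norm T.
Proof.
move=> KS KT; apply/ler_addgt0Pl => e e0.
have na : 0 < `|a| + 1 by rewrite ltr_wpDl.
have d0 : 0 < e / (`|a| + 1) by rewrite divr_gt0.
have [S' [cS' dS Se]] := AMun_norm_approx KS d0.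
have [T' [cT' dT Te]] := AMun_norm_approx KT d0.
have cST' := AM_compact_linear `|a| cS' cT'.
rewrite (le_trans (AMun_norm_le cST' (dominates_linear a dS dT)))//.
rewrite (le_trans (opnorm_linear _ cS' cT'))// normr_id.
rewrite (le_trans (lerD (ler_wpM2l (normr_ge0 a) (ltW Se)) (ltW Te)))//.
rewrite mulrDr addrACA addrC lerD2r -{2}[_ / _]mul1r -mulrDl mulrC.
by rewrite divfK// gt_eqF.
Qed.

Lemma K_AMun_reg0 : K_AMun_reg E F 0.
Proof.
apply/K_AMun_regP; split; first exact: AM_compact0.
by exists 0; [exact: AM_compact0|move=> x _; rewrite oppr0].
Qed.

Lemma AMun_norm0 : AMun_norm (0 : E -> F) = 0.
Proof.
apply/le_anti; rewrite AMun_norm_ge0 andbT.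
have d0 : dominates (0 : E -> F) 0 by move=> x _; rewrite oppr0.
rewrite (le_trans (AMun_norm_le (@AM_compact0 R E F) d0))// opnorm_le// => x.
by rewrite normr0 mul0r.
Qed.

Lemma AMun_normD S T : K_AMun_reg E F S -> K_AMun_reg E F T ->
  AMun_norm (S + T) <= AMun_norm S + AMun_norm T.
Proof.
by move=> KS KT; have := AMun_norm_linear 1 KS KT; rewrite scale1r normr1 mul1r.
Qed.

Lemma AMun_normZ a T : K_AMun_reg E F T -> AMun_norm (a *: T) = `|a| * AMun_norm T.
Proof.
have nZ b U : K_AMun_reg E F U -> AMun_norm (b *: U) <= `|b| * AMun_norm U.
  by move=> KU; have := AMun_norm_linear b KU K_AMun_reg0; rewrite AMun_norm0 !addr0.
move=> KT; apply/le_anti; rewrite nZ//=.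
have [->|a0] := eqVneq a 0; first by rewrite normr0 mul0r AMun_norm_ge0.
rewrite -ler_pdivlMl ?normr_gt0// -normfV -{1}[T]scale1r -(mulVf a0) -scalerA nZ//.
by have := K_AMun_reg_linear a KT K_AMun_reg0; rewrite addr0.
Qed.

Lemma AMun_norm_eq0 T : K_AMun_reg E F T -> AMun_norm T = 0 -> T = 0.
Proof.
move=> KT T0; apply/funext => x; apply/eqP; rewrite -normr_le0.
by have := norm_le_AMun_norm x KT; rewrite T0 mul0r.
Qed.

Lemma K_AMun_regB S T : K_AMun_reg E F S -> K_AMun_reg E F T ->
  K_AMun_reg E F (S - T).
Proof.
by move=> KS KT; have := K_AMun_reg_linear (-1) KT KS; rewrite scaleN1r addrC.
Qed.

Lemma K_AMun_regD S T : K_AMun_reg E F S -> K_AMun_reg E F T ->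
  K_AMun_reg E F (S + T).
Proof.
by move=> KS KT; have := K_AMun_reg_linear 1 KS KT; rewrite scale1r.
Qed.

Lemma AMun_norm_distC S T : K_AMun_reg E F S -> K_AMun_reg E F T ->
  AMun_norm (S - T) = AMun_norm (T - S).
Proof.
move=> KS KT; rewrite -opprB -scaleN1r AMun_normZ; last exact: K_AMun_regB.
by rewrite normrN1 mul1r.
Qed.

End AMun_norm.

(** * The modulus of a regular AM-compact operator *)

Section cone_extension.
Context (R : realType) (E F : banachLatticeType R).

(** Put [M (u - v) = p u - p v] for positive [u], [v]; additivity of [p] makes
    this independent of the decomposition.  The one used to define [M] is
    [x = modulus x - (modulus x - x)]. *)
Lemma cone_extension (p : E -> F) :
  (forall x y, (0 : E) <= x -> (0 : E) <= y -> p (x + y) = p x + p y) ->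
  (forall a x, 0 <= a -> (0 : E) <= x -> p (a *: x) = a *: p x) ->
  exists2 M : E -> F, linear M & forall x, (0 : E) <= x -> M x = p x.
Proof.
move=> pD pZ.
pose M x := p (modulus x) - p (modulus x - x).
have mB x : (0 : E) <= modulus x - x by rewrite bl_subr_ge0 le_modulus.
have MB u v : (0 : E) <= u -> (0 : E) <= v -> M (u - v) = p u - p v.
  move=> u0 v0; apply/eqP; rewrite subr_eq addrAC -subr_eq opprK; apply/eqP.
  rewrite -!pD ?modulus_ge0 //; congr p.
  by rewrite opprB addrCA [u + (v - u)]addrC subrK.
have Mpos x : (0 : E) <= x -> M x = p x.
  have p0 : p 0 = 0 by have := pZ 0 0 (lexx 0) (lexx (0 : E)); rewrite !scale0r.
  by move=> x0; rewrite -[x in LHS]subr0 MB// p0 subr0.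
have split_pos x : x = modulus x - (modulus x - x) by rewrite subKr.
exists M => // a x y.
have MD u v : M (u + v) = M u + M v.
  have -> : u + v = (modulus u + modulus v) -
      ((modulus u - u) + (modulus v - v)).
    by rewrite opprD addrACA !subKr.
  rewrite MB; first by rewrite pD ?modulus_ge0// pD ?mB// opprD addrACA.
    by rewrite bl_addr_ge0 ?modulus_ge0.
  exact: bl_addr_ge0 (mB _) (mB _).
rewrite MD; congr (_ + _).
have [a0|a0] := leP 0 a.
  have -> : a *: x = a *: modulus x - a *: (modulus x - x).
    by rewrite -scalerBr subKr.
  by rewrite MB ?bl_scale_ge0 ?modulus_ge0 ?mB// !pZ ?modulus_ge0 ?mB// -scalerBr.
have Na0 : 0 <= - a by rewrite oppr_ge0 ltW.
have -> : a *: x = (- a) *: (modulus x - x) - (- a) *: modulus x.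
  by rewrite -scalerBr addrAC subrr add0r scalerN scaleNr opprK.
rewrite MB ?bl_scale_ge0 ?modulus_ge0 ?mB// !pZ ?modulus_ge0 ?mB//.
by rewrite -scalerBr scaleNr -scalerN opprB.
Qed.

End cone_extension.

Section operator_modulus.
Context (R : realType) (E F : banachLatticeType R).
Implicit Types (S T M : E -> F) (x y : E).

(** The Riesz-Kantorovich formula, whose right side is prescribed only on the
    positive cone. *)
Definition is_op_modulus T M :=
  forall x, (0 : E) <= x -> is_lub (T @` sym_itv x) (M x).

Lemma sym_itv_refl x : (0 : E) <= x -> sym_itv x x.
Proof. by move=> x0; split => //; rewrite (le_trans _ x0)// -oppr0 bl_leN2. Qed.

Lemma sym_itvN x y : sym_itv x y -> sym_itv x (- y).
Proof. by move=> [xy yx]; split; rewrite ?bl_leN2// -bl_leN2 opprK. Qed.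

Lemma sym_itvD x y u v : sym_itv x u -> sym_itv y v -> sym_itv (x + y) (u + v).
Proof. by move=> [xu ux] [yv vy]; split; rewrite ?opprD bl_leD. Qed.

Lemma sym_itvS x y : x <= y -> sym_itv x `<=` sym_itv y.
Proof.
move=> xy z [xz zx]; split; last exact: le_trans xy.
by apply: le_trans xz; rewrite bl_leN2.
Qed.

Lemma sym_itvZ (a : R) x y : 0 <= a -> sym_itv x y -> sym_itv (a *: x) (a *: y).
Proof. by move=> a0 [xy yx]; split; rewrite -?scalerN bl_leZ. Qed.

Lemma op_modulus_le T M x y :
  is_op_modulus T M -> (0 : E) <= x -> sym_itv x y -> T y <= M x.
Proof. by move=> TM x0 xy; apply: (TM x x0 _).1 => //; exists y. Qed.

Lemma op_modulus_dominates T M : linear T -> is_op_modulus T M -> dominates M T.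
Proof.
move=> /linear_bundle[t ->] TM x x0; have xx := sym_itv_refl x0.
rewrite (op_modulus_le TM x0 xx); split => //.
by have := op_modulus_le TM x0 (sym_itvN xx); rewrite linearN.
Qed.

Lemma op_modulus_least S T M : linear S -> linear T -> is_op_modulus T M ->
  dominates S T -> op_le M S.
Proof.
move=> lS lT TM dST x x0; apply/(TM x x0) => _ [y xy <-].
by have [] := dominates_sym_itv lS lT dST xy.
Qed.

Lemma dominates_op_modulus S T M : linear S -> linear T -> is_op_modulus T M ->
  dominates S T -> dominates S M.
Proof.
move=> lS lT TM dST x x0; split; first exact: (op_modulus_least lS lT TM).
apply: le_trans (dST x x0).1; rewrite -bl_leN2 opprK.
exact: (op_modulus_dominates lT TM x0).2.
Qed.

(** By the Riesz decomposition [sym_itv (x + y)] is the sum of [sym_itv x] and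
    [sym_itv y], so the suprema are additive on the positive cone. *)
Lemma op_modulus_cone T : linear T ->
  (forall x, (0 : E) <= x -> exists s, is_lub (T @` sym_itv x) s) ->
  exists2 M, linear M & is_op_modulus T M.
Proof.
move=> /linear_bundle[t ->] tlub.
have /choice[p pP] : forall x, exists s, (0 : E) <= x -> is_lub (t @` sym_itv x) s.
  move=> x; have [/tlub[s sP]|x0] := boolP ((0 : E) <= x); first by exists s.
  by exists 0.
have ple x y : (0 : E) <= x -> sym_itv x y -> t y <= p x.
  exact: (op_modulus_le pP).
have pD x y : (0 : E) <= x -> (0 : E) <= y -> p (x + y) = p x + p y.
  move=> x0 y0; have xy0 := bl_addr_ge0 x0 y0.
  apply/le_anti/andP; split.
    apply/(pP _ xy0) => _ [z /(Riesz_decomposition x0 y0)[u [xu yu]] <-].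
    by rewrite -(subrK u z) linearD addrC bl_leD ?ple.
  rewrite -bl_leBrDr; apply/(pP _ x0) => _ [u xu <-].
  rewrite bl_leBrDr addrC -bl_leBrDr; apply/(pP _ y0) => _ [v yv <-].
  by rewrite bl_leBrDr -linearD addrC ple//; exact: sym_itvD.
have pZ_le (a : R) x : 0 < a -> (0 : E) <= x -> p (a *: x) <= a *: p x.
  move=> a0 x0; apply/(pP _ (bl_scale_ge0 (ltW a0) x0)) => _ [z az <-].
  rewrite -[z](@scalerKV _ _ a) ?gt_eqF// linearZ.
  apply: bl_leZ; first exact: ltW.
  apply: ple => //.
  rewrite -[x](@scalerK _ _ a) ?gt_eqF//; apply: sym_itvZ => //.
  by rewrite invr_ge0 ltW.
have [|M lM Mp] := cone_extension pD.
  move=> a x; rewrite le_eqVlt => /orP[/eqP <-|a0] x0.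
    have := pD 0 0 (lexx _) (lexx _); rewrite addr0 !scale0r.
    by move=> /(congr1 (fun u => u - p 0)); rewrite addrK subrr.
  apply/le_anti/andP; split; first exact: pZ_le.
  have := @pZ_le a^-1 (a *: x); rewrite invr_gt0 scalerK ?gt_eqF// => pxa.
  rewrite -[leRHS](@scalerKV _ _ a) ?gt_eqF//.
  by apply: bl_leZ; [exact: ltW|apply: pxa => //; exact: bl_scale_ge0 (ltW a0) x0].
by exists M => // x x0; rewrite Mp//; exact: pP.
Qed.

(** AM-compactness of the modulus.  Fix a finite join [v] of values
    [T (y j)] with [M x - v] small.  For [0 <= z <= x], the Riesz decomposition
    splits each [y j] into [u j] in [sym_itv z] and a rest in
    [sym_itv (x - z)]; then [M z - T (u j) <= M x - T (y j)], because the
    difference of the two sides is [M (x - z) - T (y j - u j) >= 0].  Hence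
    [M z] differs from the join of the [T (u j)] by at most [M x - v], and
    these joins form a totally bounded set as the [T (u j)] range over
    [T @` sym_itv x]. *)
Lemma op_modulus_totally_bounded T M x : linear T -> linear M ->
  is_op_modulus T M -> (0 : E) <= x -> totally_bounded (T @` sym_itv x) ->
  (forall e : R, 0 < e ->
     exists2 v, fin_join (T @` sym_itv x) v & `|M x - v| <= e) ->
  totally_bounded (M @` sym_itv x).
Proof.
move=> lT lM TM x0 tbT Mapp.
have [t tE] := linear_bundle lT; have [m mE] := linear_bundle lM.
pose B := M @` [set z | (0 : E) <= z /\ z <= x].
have tbB : totally_bounded B.
  apply: totally_bounded_approx => e e0.
  have [v Tv Mv] := Mapp e e0.
  have [C tbC CP] : exists2 C : set F, totally_bounded C &
      forall z, (0 : E) <= z -> z <= x ->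
        exists c, [/\ C c, c <= M z & M z + v <= c + M x].
    (* C collects the joins of the T (u j); the last inequality is the bound
       M z - c <= M x - v without subtractions. *)
    elim: Tv => [_ [y xy <-]|v1 v2 _ [C1 tb1 CP1] _ [C2 tb2 CP2]].
      exists (T @` sym_itv x) => // z z0 zx.
      have zx0 : (0 : E) <= x - z by rewrite bl_subr_ge0.
      have [u [zu yu]] : exists u, sym_itv z u /\ sym_itv (x - z) (y - u).
        by apply: Riesz_decomposition => //; rewrite addrC subrK.
      exists (T u); split; [by exists u => //; exact: sym_itvS zu| |].
        exact: op_modulus_le zu.
      have -> : T y = T (y - u) + T u by rewrite tE -linearD subrK.
      have -> : M x = M z + M (x - z) by rewrite mE -linearD addrC subrK.
      rewrite [T _ + T u]addrC addrCA !bl_leD2lE.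
      exact: op_modulus_le yu.
    exists [set Order.join c1 c2 | c1 in C1 & c2 in C2].
      by apply: totally_bounded_image2 => // a b c d; exact: norm_join_sub.
    move=> z z0 zx; have [c1 [Cc1 c1M c1P]] := CP1 z z0 zx.
    have [c2 [Cc2 c2M c2P]] := CP2 z z0 zx.
    exists (Order.join c1 c2); split; first by exists c1 => //; exists c2.
      by rewrite leUx c1M.
    rewrite [M z + _]addrC (join_addr v1) leUx ![_ + M z]addrC.
    by rewrite (le_trans c1P) ?(le_trans c2P)// bl_leD2rE ?leUl ?leUr.
  exists C => // _ [z [z0 zx] <-]; have [c [Cc cM cP]] := CP z z0 zx.
  exists c => //; apply: le_trans Mv; apply: bl_norm_le_ge0.
    by rewrite bl_subr_ge0.
  by rewrite bl_leBlDr addrC addrA bl_leBrDr.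
(* sym_itv x is the image of [0, x] under z |-> z + z - x. *)
pose f (b : F) := b + b - M x.
apply: (@totally_bounded_subset _ _ _ (f @` B)).
  move=> _ [y [xy yx] <-]; exists (M (2^-1 *: (y + x))).
    exists (2^-1 *: (y + x)) => //; split.
      by rewrite bl_scale_ge0 ?invr_ge0// -(opprK x) bl_subr_ge0.
    by rewrite -[leRHS](bl_half_double x) bl_leZ ?invr_ge0// bl_leD2rE.
  by rewrite /f mE -linearD -scalerDr bl_half_double -linearB addrK.
apply: (@totally_bounded_image _ _ _ _ 2) => // a b.
by rewrite /f opprB addrA subrK opprD addrACA mulr_natl mulr2n ler_normD.
Qed.

Lemma op_modulus_ex S T : AM_space F \/ order_continuous_norm F ->
  AM_compact S -> AM_compact T -> dominates S T ->
  exists2 M, AM_compact M & is_op_modulus T M.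
Proof.
move=> hF [lS cS tS] [lT cT tT] dST.
have lub_ex x : (0 : E) <= x -> exists2 s, is_lub (T @` sym_itv x) s &
    forall e : R, 0 < e ->
      exists2 v, fin_join (T @` sym_itv x) v & `|s - v| <= e.
  move=> x0; apply: (@totally_bounded_lub _ _ _ (S x)) => //.
  - by exists (T x), x => //; exact: sym_itv_refl.
  - exact: tT.
  - by move=> _ [y xy <-]; have [] := dominates_sym_itv lS lT dST xy.
have [|M lM TM] := op_modulus_cone lT.
  by move=> x /lub_ex[s sP _]; exists s.
exists M => //; split => //.
  apply: (@bound_linear_continuous _ _ _ _ (opnorm S)) => // x.
  by apply: dominates_opnorm => //; exact: dominates_op_modulus TM dST.
move=> x x0; apply: (op_modulus_totally_bounded lT lM TM x0 (tT x x0)).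
have [s sP sapp] := lub_ex x x0.
suff -> : M x = s by [].
apply/le_anti/andP; split.
  by apply/(TM x x0); apply/sP.
by apply/sP; apply/(TM x x0).
Qed.

Lemma op_modulus_norm T M x : linear M -> K_AMun_reg E F T -> is_op_modulus T M ->
  `|M x| <= AMun_norm T * `|x|.
Proof.
move=> lM KT TM; apply: AMun_norm_bound => // S [lS cS _] dST.
apply: dominates_opnorm => //.
by apply: dominates_op_modulus TM dST => //; have [[]] := KT.
Qed.

(** The analogue for operators of [| |s| - |t| | <= |s - t|]. *)
Lemma op_modulus_dist S T MS MT MD : linear S -> linear T -> linear MS ->
  linear MT -> linear MD -> is_op_modulus S MS -> is_op_modulus T MT ->
  is_op_modulus (S - T) MD -> dominates MD (MS - MT).
Proof.
move=> lS lT lMS lMT lMD mS mT mD x x0.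
have [s sE] := linear_bundle lS; have [t tE] := linear_bundle lT.
rewrite -[(MS - MT) x]/(MS x - MT x).
split.
  rewrite bl_leBlDr; apply/(mS x x0) => _ [y xy <-].
  rewrite -(subrK (T y) (S y)) bl_leD//; first exact: (op_modulus_le mD).
  exact: op_modulus_le xy.
rewrite opprB bl_leBlDr; apply/(mT x x0) => _ [y xy <-].
rewrite -(subrK (S y) (T y)) bl_leD//; last exact: op_modulus_le xy.
have -> : T y - S y = (S - T) (- y).
  by rewrite -[RHS]/(S (- y) - T (- y)) sE tE !linearN opprK addrC.
by apply: (op_modulus_le mD) => //; exact: sym_itvN.
Qed.

End operator_modulus.

(** * Completeness *)

Section completeness.
Context (R : realType) (E F : banachLatticeType R).
Context (hF : AM_space F \/ order_continuous_norm F).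
Implicit Types (S T L M : E -> F) (x y : E).

Lemma K_AMun_reg_modulus T : K_AMun_reg E F T ->
  exists2 M, AM_compact M & is_op_modulus T M.
Proof. by move=> /K_AMun_regP[cT [S cS dST]]; exact: op_modulus_ex dST. Qed.

Lemma dominates_reg M T : AM_compact M -> dominates M T -> K_AMun_reg E F M.
Proof.
move=> cM dMT; apply/K_AMun_regP; split=> //; exists M => // x x0.
have M0 := dominates_ge0 dMT x0; split => //.
by apply: le_trans M0; rewrite -oppr0 bl_leN2; exact: dominates_ge0 dMT x0.
Qed.

Lemma op_modulus_lipschitz S T MS MT x : K_AMun_reg E F S -> K_AMun_reg E F T ->
  AM_compact MS -> AM_compact MT -> is_op_modulus S MS -> is_op_modulus T MT ->
  `|MS x - MT x| <= AMun_norm (S - T) * `|x|.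
Proof.
move=> KS KT cMS cMT mS mT; have KST := K_AMun_regB KS KT.
have [MD [lMD _ _] mD] := K_AMun_reg_modulus KST.
have lin U : K_AMun_reg E F U -> linear U by move=> [[]].
have [[lMS _ _] [lMT _ _]] := (cMS, cMT).
have dMD := op_modulus_dist (lin _ KS) (lin _ KT) lMS lMT lMD mS mT mD.
have lB : linear (MS - MT).
  by have [] := AM_compact_linear (-1) cMT cMS; rewrite scaleN1r addrC.
have := dominates_norm x lMD lB dMD; rewrite -[(MS - MT) x]/(MS x - MT x).
move=> /le_trans; apply; rewrite -(norm_modulus x).
exact: op_modulus_norm.
Qed.

(** The estimate behind completeness.  Choose moduli [md (S - T)] for the
    members [S] of the filter: they are Cauchy with the [S], so they converge
    in operator norm to an AM-compact [M], which dominates [L - T] because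
    positivity is preserved by limits.  So [M] shows that [L - T] is regular
    and bounds its AM-un-norm. *)
Lemma limit_sub_reg (G : set_system (E -> F)) L T (d : R) : ProperFilter G ->
  G (K_AMun_reg E F) ->
  (forall e : R, 0 < e ->
     exists2 T, K_AMun_reg E F T & G [set S | AMun_norm (T - S) < e]) ->
  AM_compact L ->
  (forall e : R, 0 < e -> G [set S | forall x, `|L x - S x| <= e * `|x|]) ->
  K_AMun_reg E F T -> 0 < d -> G [set S | AMun_norm (S - T) < d] ->
  K_AMun_reg E F (L - T) /\ AMun_norm (L - T) <= d.
Proof.
move=> PG GK Gc cL GL KT d0 GTd.
have /choice[md mdP] : forall U, exists M,
    K_AMun_reg E F U -> AM_compact M /\ is_op_modulus U M.
  move=> U; have [/K_AMun_reg_modulus[M cM UM]|nU] := pselect (K_AMun_reg E F U).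
    by exists M.
  by exists 0.
pose H := (fun S => md (S - T)) @ G.
have [||M cM HM] := @AM_compact_limit R E F H _.
- apply: (@filterS _ G _ _ _ _ GK) => S KS.
  by have [] := mdP _ (K_AMun_regB KS KT).
- move=> e e0; have [U KU GU] := Gc e e0; exists (md (U - T)).
  apply: (@filterS2 _ G _ _ _ _ _ GK GU) => S /= KS US x.
  have [KST KUT] := (K_AMun_regB KS KT, K_AMun_regB KU KT).
  have [[cMS mS] [cMU mU]] := (mdP _ KST, mdP _ KUT).
  apply: (le_trans (op_modulus_lipschitz x KST KUT cMS cMU mS mU)).
  have -> : S - T - (U - T) = S - U by rewrite opprB addrA subrK.
  by rewrite ler_wpM2r// AMun_norm_distC// ltW.
have GM (e : R) : 0 < e -> G [set S | forall x, `|M x - md (S - T) x| <= e * `|x|].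
  exact: HM.
have approx x (e : R) : 0 < e -> exists S, [/\ K_AMun_reg E F S,
    AMun_norm (S - T) < d, `|L x - S x| <= e & `|M x - md (S - T) x| <= e].
  move=> e0; have ex : 0 < e / (`|x| + 1) by rewrite divr_gt0// ltr_wpDl.
  have [S [[KS ST] [LS MS]]] :=
    filter_ex (filterI (filterI GK GTd) (filterI (GL _ ex) (GM _ ex))).
  have small := ltW (ltr_div_succ_mul e0 (normr_ge0 x)).
  by exists S; split; rewrite // (le_trans _ small).
have dM : dominates M (L - T).
  move=> x x0; rewrite -[(L - T) x]/(L x - T x).
  have dS S : K_AMun_reg E F S -> S x - T x <= md (S - T) x /\
      - (S x - T x) <= md (S - T) x.
    move=> KS; have [_ mS] := mdP _ (K_AMun_regB KS KT).
    have lST : linear (S - T) by have [[]] := K_AMun_regB KS KT.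
    exact: (op_modulus_dominates lST mS x0).
  split; apply: bl_le_closed => e e0.
    have [S [KS _ LS MS]] := approx x _ (divr_gt0 e0 (ltr0n R 2)).
    exists (md (S - T) x - (S x - T x)); first by rewrite bl_subr_ge0 (dS S KS).1.
    have -> : M x - (L x - T x) - (md (S - T) x - (S x - T x)) =
        (M x - md (S - T) x) - (L x - S x).
      by rewrite subr_subACA [- (S x - T x)]opprB addrA subrK.
    by rewrite (le_trans (ler_normB _ _))// [e]splitr lerD.
  have [S [KS _ LS MS]] := approx x _ (divr_gt0 e0 (ltr0n R 2)).
  exists (md (S - T) x + (S x - T x)).
    by rewrite -(opprK (S x - T x)) bl_subr_ge0 (dS S KS).2.
  have -> : M x - - (L x - T x) - (md (S - T) x + (S x - T x)) =
      (M x - md (S - T) x) + (L x - S x).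
    by rewrite opprK opprD addrACA; congr (_ + _); rewrite opprB addrA subrK.
  by rewrite (le_trans (ler_normD _ _))// [e]splitr lerD.
have cLT : AM_compact (L - T).
  have [cT _] := (K_AMun_regP T).1 KT.
  by have := AM_compact_linear (-1) cT cL; rewrite scaleN1r addrC.
split; first by apply/K_AMun_regP; split=> //; exists M.
apply: le_trans (AMun_norm_le cM dM) _.
apply: opnorm_le => [|x]; first exact: ltW.
apply/ler_addgt0Pl => e e0; have [S [KS ST _ MS]] := approx x e e0.
rewrite -(subrK (md (S - T) x) (M x)) (le_trans (ler_normD _ _))// lerD//.
have [[lm _ _] mS] := mdP _ (K_AMun_regB KS KT).
rewrite (le_trans (op_modulus_norm _ lm (K_AMun_regB KS KT) mS))//.
by rewrite ler_wpM2r// ltW.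
Qed.

Lemma K_AMun_reg_complete (G : set_system (E -> F)) : ProperFilter G ->
  G (K_AMun_reg E F) ->
  (forall e : R, 0 < e ->
     exists2 T, K_AMun_reg E F T & G [set S | AMun_norm (T - S) < e]) ->
  exists2 L, K_AMun_reg E F L &
    forall e : R, 0 < e -> G [set S | AMun_norm (L - S) < e].
Proof.
move=> PG GK Gc.
have KAM T : K_AMun_reg E F T -> AM_compact T by move=> /K_AMun_regP[].
have [L cL GL] : exists2 L, AM_compact L &
    forall e : R, 0 < e -> G [set S | forall x, `|L x - S x| <= e * `|x|].
  apply: AM_compact_limit; first exact: (@filterS _ G _ _ _ KAM GK).
  move=> e e0; have [T KT GT] := Gc e e0; exists T.
  apply: (@filterS2 _ G _ _ _ _ _ GK GT) => S /= KS TS x.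
  rewrite distrC (le_trans (norm_le_AMun_norm x (K_AMun_regB KT KS)))//.
  by rewrite ler_wpM2r// ltW.
have LT (e : R) : 0 < e -> exists T, [/\ K_AMun_reg E F T,
    G [set S | AMun_norm (T - S) < e], K_AMun_reg E F (L - T) &
    AMun_norm (L - T) <= e].
  move=> e0; have [T KT GT] := Gc e e0; exists T.
  have GT' : G [set S | AMun_norm (S - T) < e].
    by apply: (@filterS2 _ G _ _ _ _ _ GK GT) => S /= KS; rewrite AMun_norm_distC.
  by have [KLT nLT] := limit_sub_reg PG GK Gc cL GL KT e0 GT'; split.
have KL : K_AMun_reg E F L.
  have [T [KT _ KLT _]] := LT 1 ltr01.
  by rewrite -(subrK T L); exact: K_AMun_regD.
exists L => // e e0; have [T [KT GT KLT nLT]] := LT _ (divr_gt0 e0 (ltr0n R 2)).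
apply: (@filterS2 _ G _ _ _ _ _ GK GT) => S /= KS TS.
have -> : L - S = (L - T) + (T - S) by rewrite subrKA.
apply: le_lt_trans (AMun_normD KLT (K_AMun_regB KT KS)) _.
by rewrite [e]splitr ler_ltD.
Qed.

End completeness.

(** * Banach lattices carried by subsets of a vector space *)

(** Data on a subset of [V] that make it a Banach lattice.  Moduli stand for all
    joins, as [2^-1 *: (x + y + |x - y|)] is the join of [x] and [y].  Monotonicity
    of the norm compares [|x|] with [|y|] through their upper bounds, so that it
    can be checked without computing a modulus.  Completeness is a statement on
    filters because [V] has no topology. *)
Record lattice_normed_set (R : realType) (V : lmodType R) := LatticeNormedSet {
  lns_set : set V ;
  lns_le : V -> V -> Prop ;
  lns_norm : V -> R ;
  lns_0 : lns_set 0 ;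
  lns_lin : forall a x y, lns_set x -> lns_set y -> lns_set (a *: x + y) ;
  lns_refl : forall x, lns_le x x ;
  lns_trans : forall x y z, lns_le x y -> lns_le y z -> lns_le x z ;
  lns_anti : forall x y, lns_set x -> lns_set y ->
    lns_le x y -> lns_le y x -> x = y ;
  lns_leD2r : forall x y z, lns_le x y -> lns_le (x + z) (y + z) ;
  lns_scale : forall a x, 0 <= a -> lns_le 0 x -> lns_le 0 (a *: x) ;
  lns_modulus : forall x, lns_set x -> exists2 m, lns_set m &
    forall z, lns_set z -> (lns_le m z <-> lns_le x z /\ lns_le (- x) z) ;
  lns_normD : forall x y, lns_set x -> lns_set y ->
    lns_norm (x + y) <= lns_norm x + lns_norm y ;
  lns_normZ : forall a x, lns_set x -> lns_norm (a *: x) = `|a| * lns_norm x ;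
  lns_norm0 : forall x, lns_set x -> lns_norm x = 0 -> x = 0 ;
  lns_norm_mono : forall x y, lns_set x -> lns_set y ->
    (forall z, lns_set z -> lns_le y z -> lns_le (- y) z ->
       lns_le x z /\ lns_le (- x) z) ->
    lns_norm x <= lns_norm y ;
  lns_complete : forall G : set_system V, ProperFilter G -> G lns_set ->
    (forall e, 0 < e ->
       exists2 x, lns_set x & G [set y | lns_norm (x - y) < e]) ->
    exists2 l, lns_set l &
      forall e, 0 < e -> G [set y | lns_norm (l - y) < e]
}.

Section banach_lattice_of_set.
Context (R : realType) (V : lmodType R) (A : lattice_normed_set V).

Let inA : {pred V} := fun x => `[< lns_set A x >].

Let inAP x : reflect (lns_set A x) (x \in inA).
Proof. exact: asboolP. Qed.

Let inA_submod_closed : submod_closed inA.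
Proof.
split; first by apply/inAP; exact: lns_0.
by move=> a x y /inAP Ax /inAP Ay; apply/inAP; exact: lns_lin.
Qed.

HB.instance Definition _ := GRing.isSubmodClosed.Build R V inA inA_submod_closed.

Definition lns_type := {x : V | inA x}.

HB.instance Definition _ := SubType.on lns_type.
HB.instance Definition _ := Choice.on lns_type.
HB.instance Definition _ := [SubChoice_isSubLmodule of lns_type by <:].

Let valA (x : lns_type) : lns_set A (val x).
Proof. by apply/inAP; exact: (valP x). Qed.

Let nrm (x : lns_type) : R := lns_norm A (val x).

Let nrmD x y : nrm (x + y) <= nrm x + nrm y.
Proof. exact: lns_normD. Qed.

Let nrmZ a x : nrm (a *: x) = `|a| * nrm x.
Proof. by rewrite /nrm linearZ /= (lns_normZ a (valA x)). Qed.

Let nrm0 x : nrm x = 0 -> x = 0.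
Proof. by move=> x0; apply/val_inj; exact: lns_norm0 x0. Qed.

HB.instance Definition _ := Lmodule_isNormed.Build R lns_type nrmD nrmZ nrm0.

Let cauchy_cvg_lns (G : set_system lns_type) :
  ProperFilter G -> cauchy G -> cvg G.
Proof.
move=> PG /cauchyP cG.
have [|e e0|l Al Gl] := @lns_complete _ _ A (val @ G) _.
- by apply: (@filterS _ G _ setT) => [x _|]; [exact: (valA x)|exact: filterT].
- have [x Gx] := cG e e0; exists (val x); first exact: (valA x).
  by apply: (@filterS _ G _ (ball x e)) Gx => y; rewrite -ball_normE.
- suff : G --> (exist _ l (asboolT Al) : lns_type) by apply: cvgP.
  apply: (proj2 (@cvgrPdist_lt R lns_type _ G _ idfun _)) => e e0; exact: Gl.
Qed.

HB.instance Definition _ := Uniform_isComplete.Build lns_type cauchy_cvg_lns.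

Let le (x y : lns_type) : bool := `[< lns_le A (val x) (val y) >].

Let leD2r x y z : le x y -> le (x + z) (y + z).
Proof. by move=> /asboolP xy; apply/asboolP; exact: lns_leD2r. Qed.

Let scaler_ge0 (a : R) x : 0 <= a -> le 0 x -> le 0 (a *: x).
Proof. by move=> a0 /asboolP x0; apply/asboolP; exact: lns_scale. Qed.

Let le_refl : reflexive le.
Proof. by move=> x; apply/asboolP; exact: lns_refl. Qed.

Let le_trans : transitive le.
Proof.
by move=> y x z /asboolP xy /asboolP yz; apply/asboolP; exact: lns_trans yz.
Qed.

Let le_anti : antisymmetric le.
Proof.
by move=> x y /andP[/asboolP xy /asboolP yx]; apply/val_inj; exact: (lns_anti (valA x)).
Qed.

Let modulus_ex (x : lns_type) :
  {m : lns_type | forall z, le m z = le x z && le (- x) z}.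
Proof.
apply: cid; have [m Am Pm] := lns_modulus (valA x).
exists (exist _ m (asboolT Am) : lns_type) => z.
apply/asboolP/andP => [/(Pm _ (valA z))[xz Nxz]|[/asboolP xz /asboolP Nxz]].
  by split; apply/asboolP.
exact/(Pm _ (valA z)).
Qed.

Let absl x := sval (modulus_ex x).

Let abslP x z : le (absl x) z = le x z && le (- x) z.
Proof. by rewrite /absl; case: modulus_ex. Qed.

Let leDr x y z : le (x + z) (y + z) = le x y.
Proof.
by apply/idP/idP => /leD2r; [move=> /(_ (- z)); rewrite !addrK|].
Qed.

Let leZ (a : R) x y : 0 < a -> le (a *: x) (a *: y) = le x y.
Proof.
have sub0 u v : le u v = le 0 (v - u) by rewrite -(leDr _ _ (- u)) subrr.
have imp b u v : 0 < b -> le u v -> le (b *: u) (b *: v).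
  rewrite (sub0 u) (sub0 (_ *: _)) -scalerBr => b0 uv.
  by apply: scaler_ge0 uv; exact: ltW.
move=> a0; apply/idP/idP; last exact: imp.
by rewrite -invr_gt0 in a0; move=> /(imp _ _ _ a0); rewrite !scalerK// -invr_eq0 gt_eqF.
Qed.

Let join x y : lns_type := 2^-1 *: (x + y + absl (x - y)).

Let joinP x y z : le (join x y) z = le x z && le y z.
Proof.
have half u : u = 2^-1 *: (u + u) :> lns_type.
  by rewrite scalerDr -scalerDl -[2^-1]div1r -splitr scale1r.
rewrite [in LHS](half z) leZ ?invr_gt0// addrC -(leDr _ _ (- (x + y))) addrK abslP opprB.
rewrite -(leDr _ _ (x + y)) subrK -[in X in _ && X](leDr _ _ (x + y)) subrK.
have dbl u : le (u + u) (z + z) = le u z.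
  by rewrite [in RHS](half u) [in RHS](half z) leZ// invr_gt0.
rewrite -dbl -[le y z]dbl; congr (le _ _ && le _ _).
  by rewrite addrACA [- y + _]addrC subrr addr0.
by rewrite addrA subrK.
Qed.

Let meet x y : lns_type := - join (- x) (- y).

Let leN x y : le (- x) (- y) = le y x.
Proof. by rewrite -(leDr _ _ (x + y)) addKr addrCA addNr addr0. Qed.

Let meetP x y z : le x (meet y z) = le x y && le x z.
Proof. by rewrite /meet -[x in LHS]opprK leN joinP !leN. Qed.

Let norm_mono x y : le (join x (- x)) (join y (- y)) -> `|x| <= `|y|.
Proof.
rewrite joinP => /andP[xy Nxy]; apply: (lns_norm_mono (valA x) (valA y)).
move=> z Az yz Nyz; pose z' : lns_type := exist _ z (asboolT Az).
have jz : le (join y (- y)) z' by rewrite joinP; apply/andP; split; apply/asboolP.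
by split; apply/asboolP; [exact: le_trans jz|exact: le_trans Nxy jz].
Qed.

HB.instance Definition _ := isBanachLattice.Build R lns_type
  le_refl le_anti le_trans meetP joinP leD2r scaler_ge0 norm_mono.

Lemma lns_is_banach_lattice : is_banach_lattice (lns_set A) (lns_le A) (lns_norm A).
Proof.
exists lns_type, val; split => //.
- split=> [x _|x y _ _ /val_inj//|x Ax]; first exact: (valA x).
  by exists (exist _ x (asboolT Ax)).
- by move=> x y; split=> [/asboolP|xy] //; apply/asboolP.
Qed.

End banach_lattice_of_set.

(** * The Banach lattice of regular AM-un-compact operators *)

Lemma op_leD2r (R : realType) (E F : banachLatticeType R) (S T U : E -> F) :
  op_le S T -> op_le (S + U) (T + U).
Proof. by move=> ST x x0; rewrite bl_leD2rE; exact: ST. Qed.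

Lemma K_AMun_reg_anti (R : realType) (E F : banachLatticeType R) (S T : E -> F) :
  K_AMun_reg E F S -> K_AMun_reg E F T -> op_le S T -> op_le T S -> S = T.
Proof.
move=> [[/linear_bundle[s ->] _ _] _] [[/linear_bundle[t ->] _ _] _] st ts.
have pos x : (0 : E) <= x -> s x = t x.
  by move=> x0; apply/le_anti; rewrite (st x x0) (ts x x0).
apply/funext => x; have mx : (0 : E) <= modulus x - x.
  by rewrite bl_subr_ge0 le_modulus.
rewrite -(subKr (modulus x) x) (linearB s) (linearB t) (pos _ mx).
by rewrite (pos _ (modulus_ge0 x)).
Qed.

Section banach_lattice.
Context (R : realType) (E F : banachLatticeType R).
Context (hF : AM_space F \/ order_continuous_norm F).

Let reg_modulus (T : E -> F) : K_AMun_reg E F T ->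
  exists2 M, K_AMun_reg E F M & forall U, K_AMun_reg E F U ->
    (op_le M U <-> op_le T U /\ op_le (- T) U).
Proof.
move=> KT; have [M cM TM] := K_AMun_reg_modulus hF KT.
have lT : linear T by have [[]] := KT.
have dMT := op_modulus_dominates lT TM.
exists M => [|U KU]; first exact: dominates_reg dMT.
split=> [MU|[TU NTU]].
  by split=> x x0; apply: le_trans (MU x x0); have [] := dMT x x0.
apply: (op_modulus_least _ lT TM); first by have [[]] := KU.
by move=> x x0; split; [exact: TU|exact: NTU].
Qed.

Let norm_mono (S T : E -> F) : K_AMun_reg E F S -> K_AMun_reg E F T ->
  (forall U, K_AMun_reg E F U -> op_le T U -> op_le (- T) U ->
     op_le S U /\ op_le (- S) U) -> AMun_norm S <= AMun_norm T.
Proof.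
move=> KS KT ST; apply/ler_addgt0Pl => e e0.
have [U [cU dU Ue]] := AMun_norm_approx KT e0.
rewrite addrC; apply: le_trans (ltW Ue); apply: AMun_norm_le => // x x0.
have [||SU NSU] := ST U (dominates_reg cU dU).
- by move=> y y0; have [] := dU y y0.
- by move=> y y0; have [] := dU y y0.
by split; [exact: SU|exact: NSU].
Qed.

Definition K_AMun_lns : lattice_normed_set (E -> F) :=
  @LatticeNormedSet R (E -> F) (K_AMun_reg E F) (@op_le R E F)
    (@AMun_norm R E F) (K_AMun_reg0 E F) (@K_AMun_reg_linear R E F)
    (fun T x _ => lexx (T x))
    (fun S T U ST TU x x0 => le_trans (ST x x0) (TU x x0))
    (@K_AMun_reg_anti R E F) (@op_leD2r R E F)
    (fun a T a0 T0 x x0 => bl_scale_ge0 a0 (T0 x x0))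
    reg_modulus (@AMun_normD R E F) (@AMun_normZ R E F) (@AMun_norm_eq0 R E F)
    norm_mono (@K_AMun_reg_complete R E F hF).

End banach_lattice.

Theorem corollary3p10 (R : realType) (E F : banachLatticeType R)
    (hF : AM_space F \/ order_continuous_norm F) :
  is_banach_lattice (K_AMun_reg E F) (@op_le R E F) (@AMun_norm R E F).
Proof. exact: (lns_is_banach_lattice (K_AMun_lns E hF)). Qed.
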